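(* Let $n\ge1$ be an integer, let $p\in(0,1/2]$, $q=1-p$, and let $X_1,\dots,X_n$ be independent and identically distributed random variables with $$\mathbf{P}\left(X_1=\sqrt{p/q}\right)=q,\qquad \mathbf{P}\left(X_1=-\sqrt{q/p}\right)=p.$$ Let $t_n^*=\sum_{i=1}^nX_i\Big/\left(\sum_{i=1}^nX_i^2\right)^{1/2}$ and $$Y=\frac{np-\pi_{np}}{\sqrt{np^2+(1-2p)\pi_{np}}},$$ where $\pi_{np}$ is a Poisson random variable with parameter $np$. Then $$d_{TV}(t_n^*;Y)\ \le\ \frac{3p}{4e}+2\left(1-e^{-np}\right)^2p^2+2\left(1-e^{-np}\right)p^2\,\varepsilon_n ,$$ where $$\varepsilon_n=\min\left\{1;\ \bigl(2\pi[(n-1)p]\bigr)^{-1/2}+\frac{2(1-e^{-np})p}{1-1/n}\right\}.$$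
   Context: For random variables $U,V$, $d_{TV}(U;V)=\sup_A|\mathbf{P}(U\in A)-\mathbf{P}(V\in A)|$ (supremum over Borel sets $A\subset\mathbb{R}$) is the total variation distance between their distributions. In the definition of $\varepsilon_n$, $\pi$ is the number $3.14\ldots$, $[\cdot]$ denotes the integer part, and a reciprocal of zero (in particular $(2\pi\cdot0)^{-1/2}$, or the last term when $n=1$) is interpreted as $+\infty$, so that $\varepsilon_n=1$ in those cases. *)

(* Defs.v *)
From HB Require Import structures.
From mathcomp Require Import all_boot all_order all_algebra.
From mathcomp Require Import all_classical all_reals all_analysis.
From mathcomp Require Import measurable_realfun.

Set Implicit Arguments.
Unset Strict Implicit.
Unset Printing Implicit Defensive.

Import Order.TTheory GRing.Theory Num.Theory.
Import numFieldNormedType.Exports.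

Local Open Scope classical_set_scope.
Local Open Scope ring_scope.

Definition mutually_independent (d : measure_display) (T : measurableType d)
    (R : realType) (P : probability T R) (I : finType)
    (X : I -> {RV P >-> R}) : Prop :=
  forall (J : {set I}) (A : I -> set R), (forall i, measurable (A i)) ->
    P (\bigcap_(i in [set` J]) (X i @^-1` A i)) =
    (\prod_(i in J) P (X i @^-1` A i))%E.

(* The two random variables may live on different probability spaces. *)
Definition dTV (d d' : measure_display)
    (T : measurableType d) (T' : measurableType d') (R : realType)
    (P : probability T R) (Q : probability T' R)
    (U : {RV P >-> R}) (V : {RV Q >-> R}) : \bar R :=
  ereal_sup [set `|distribution P U A - distribution Q V A|%E |
             A in (measurable : set (set R))].

Definition is_poisson (d : measure_display) (T : measurableType d)
    (R : realType) (P : probability T R) (rate : R)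
    (N : {RV P >-> nat}) : Prop :=
  forall k : nat, P (N @^-1` [set k]) = (poisson_pmf rate k)%:E.

Section self_normalized_sum.
Context (d : measure_display) (T : measurableType d) (R : realType)
  (P : probability T R) (n : nat).
Implicit Type X : 'I_n -> {RV P >-> R}.

Definition self_normalized_sum X (w : T) : R :=
  (\sum_(i < n) X i w) / Num.sqrt (\sum_(i < n) X i w ^+ 2).

Lemma measurable_self_normalized_sum X :
  measurable_fun setT (self_normalized_sum X).
Proof.
apply: measurable_funM; first by apply: measurable_sum => i; exact: measurable_funP.
have -> : (fun w => (Num.sqrt (\sum_(i < n) X i w ^+ 2))^-1) =
  ((fun x : R => x `^ (-1)) \o (fun x : R => x `^ 2^-1)) \o
    (fun w => \sum_(i < n) X i w ^+ 2).
  apply/funext => w /=.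
  by rewrite powR12_sqrt ?powR_inv1 ?sqrtr_ge0// sumr_ge0// => i _; exact: sqr_ge0.
apply: measurableT_comp.
  by apply: measurableT_comp; exact: measurable_powR.
by apply: measurable_sum => i; apply: measurable_funX; exact: measurable_funP.
Qed.

HB.instance Definition _ X := isMeasurableFun.Build _ _ _ _
  (self_normalized_sum X) (measurable_self_normalized_sum X).

End self_normalized_sum.

Section normalized_poisson.
Context (d : measure_display) (T : measurableType d) (R : realType)
  (P : probability T R) (n : nat) (p : R).
Implicit Type N : {RV P >-> nat}.

Definition normalized_poisson N (w : T) : R :=
  (n%:R * p - (N w)%:R) /
  Num.sqrt (n%:R * p ^+ 2 + (1 - 2 * p) * (N w)%:R).

Lemma measurable_normalized_poisson N :
  measurable_fun setT (normalized_poisson N).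
Proof.
by apply: (@measurableT_comp _ _ _ _ _ _ (fun k : nat => (n%:R * p - k%:R) /
  Num.sqrt (n%:R * p ^+ 2 + (1 - 2 * p) * k%:R))); last exact: measurable_funP.
Qed.

HB.instance Definition _ N := isMeasurableFun.Build _ _ _ _
  (normalized_poisson N) (measurable_normalized_poisson N).

End normalized_poisson.

(* Both reciprocals are taken in \bar R, where 0^-1 = +oo and where x / 0 = +oo
   for x > 0. *)
Definition epsilon (R : realType) (n : nat) (p : R) : \bar R :=
  Order.min 1%E
    ((Num.sqrt (2 * pi * (Num.floor ((n%:R - 1) * p))%:~R))%:E^-1
     + (2 * (1 - expR (- (n%:R * p))) * p)%:E / (1 - n%:R^-1)%:E)%E.

(* Main.v *)
Require Import Defs.
From HB Require Import structures.
From mathcomp Require Import all_boot all_order all_algebra.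
From mathcomp Require Import all_classical all_reals all_analysis.
From mathcomp Require Import ring lra zify.

Set Implicit Arguments.
Unset Strict Implicit.
Unset Printing Implicit Defensive.

Import Order.TTheory GRing.Theory Num.Theory.
Import numFieldNormedType.Exports.

Local Open Scope classical_set_scope.
Local Open Scope ring_scope.

(** Let k be the number of the X_i equal to [- sqrt (q / p)]. Then t_n^* is a
    fixed function f of k, and Y is the same f of the Poisson variable, so the
    left-hand side is at most the total variation distance between the
    binomial law Bin(n, p) and the Poisson law of rate lam = n p. This distance
    is bounded by two rounds of the Stein-Chen method.

    For h with values in [0, 1] let g be the solution of
    lam g(j+1) - j g(j) = h(j) - E h(Poisson), and Dh(j) = g(j+2) - g(j+1).
    Size biasing the binomial law gives the identity
    E h(Bin(n, p)) - E h(Poisson) = lam p E Dh(Bin(n-1, p))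
    ([binomial_poisson_stein]), and the classical estimate is
    lam |Dh| <= (1 - e^-lam) (sup h - inf h) ([stein_diff_le]). In the
    right-hand side of the identity, Bin(n-1, p) is replaced first by Bin(n, p)
    and then by the Poisson law.

    - The first replacement costs p E(Dh(. + 1) - Dh) under Bin(n-1, p); as that
      law is unimodal, this is at most 2 sup |Dh| times its largest atom. The
      largest atom is within (1 - e^-lam) p of the largest atom of a Poisson law
      of rate (n-1) p, which Stirling's formula bounds by
      1 / sqrt (2 pi [(n-1) p]); hence epsilon_n ([binomial_pmf_le_epsilon]).
    - The second replacement is the Stein-Chen identity again, applied to Dh; it
      yields the term in (1 - e^-lam)^2 p^2.
    - What remains is lam p E Dh(Poisson). Summation by parts turns it into the
      integral of h against the second difference of the Poisson law, so it is
      at most p times lam / 4 times the l^1 norm of that second difference. This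
      norm telescopes over the interval where the difference is negative, which
      leaves the inequality
      pmf(m) (lam - m) + pmf(b) (b - lam) <= 3 / (2 e)
      ([poisson_extremal_le]), with equality at lam = 1, m = 0, b = 2. It gives
      the leading term 3 p / (4 e). For m = 0 and m = 1 it is a comparison of
      polynomials with the exponential; for larger m both summands are estimated
      separately, mostly by Stirling's formula.

    Stirling's lower bound with its sharp constant comes from Wallis' integrals
    ([central_binomial_le], [stirling_le]). *)

(** * Elementary bounds on the exponential and the sine *)

Section Calculus.
Context {R : realType}.
Implicit Types (f df : R -> R) (a b x y t : R).

Lemma is_derive_ge0_le f df a b : a <= b ->
  (forall t, t \in `[a, b] -> is_derive t 1 f (df t)) ->
  (forall t, t \in `[a, b] -> 0 <= df t) -> f a <= f b.
Proof.
move=> ab fdf df0.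
move: ab; rewrite le_eqVlt => /predU1P[->//|ab].
have fdf' t : t \in `]a, b[ -> is_derive t 1 f (df t).
  by move=> tab; apply: fdf; apply: subset_itv_oo_cc.
have cf : {within `[a, b], continuous f}.
  apply: derivable_within_continuous => t tab.
  exact: (@ex_derive _ _ _ _ _ _ _ (fdf t tab)).
have [c cab fc] := MVT ab fdf' cf.
rewrite -subr_ge0 fc mulr_ge0 ?subr_ge0 ?(ltW ab)// df0//.
exact: subset_itv_oo_cc.
Qed.

Lemma expR_ge_taylor n x : 0 <= x -> \sum_(i < n) x ^+ i / i`!%:R <= expR x.
Proof.
move=> x0.
rewrite -[leLHS](big_mkord xpredT (fun i => x ^+ i / i`!%:R)).
apply: (nondecreasing_cvgn_le (u_ := series (exp_coeff x))).
  apply/nondecreasing_seqP => k; rewrite /series/= big_nat_recr//= lerDl.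
  by rewrite /exp_coeff divr_ge0 ?exprn_ge0.
exact: is_cvg_series_exp_coeff.
Qed.

Lemma expRN_le2 y : 0 <= y -> expR (- y) <= 1 - y + y ^+ 2 / 2.
Proof.
move=> y0.
pose f := fun t : R => 1 - t + t ^+ 2 / 2 - expR (- t).
have : f 0 <= f y.
  apply: (@is_derive_ge0_le _ (fun t => - 1 + t + expR (- t)) _ _ y0) => t _.
    by apply: is_derive_eq; rewrite /GRing.scale/=; field.
  by have := expR_ge1Dx (- t); lra.
by rewrite /f oppr0 expR0; lra.
Qed.

(** Taylor polynomials of odd degree stay below the exponential on the whole
    line, negative arguments included. *)
Lemma expR_ge_cubic x : 1 + x + x ^+ 2 / 2 + x ^+ 3 / 6 <= expR x.
Proof.
have [x0|/ltW x0] := leP 0 x.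
  have := expR_ge_taylor 4 x0.
  rewrite !big_ord_recr big_ord0/= add0r expr0 expr1 !factS fact0 /= !mul1n !muln1.
  by move/(le_trans _); apply; lra.
pose f := fun t : R => expR (- t) - (1 - t + t ^+ 2 / 2 - t ^+ 3 / 6).
have y0 : 0 <= - x by rewrite oppr_ge0.
have : f 0 <= f (- x).
  apply: (@is_derive_ge0_le _ (fun t => 1 - t + t ^+ 2 / 2 - expR (- t)) _ _ y0) => t.
    by move=> _; apply: is_derive_eq; rewrite /GRing.scale/=; field.
  rewrite in_itv/= => /andP[t0 _].
  by rewrite subr_ge0 expRN_le2.
by rewrite /f oppr0 expR0 opprK; lra.
Qed.

Lemma expR1_le : expR 1 <= 547 / 200 :> R.
Proof.
have := expR_ge_cubic (- 4^-1); set a := expR _ => h.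
have {}h : 389 / 500 <= a by lra.
have h2 : 121 / 200 <= a ^+ 2 by nra.
have h4 : 366 / 1000 <= (a ^+ 2) ^+ 2 by nra.
have : (a ^+ 2) ^+ 2 * expR 1 = 1.
  rewrite -exprM -expRM_natl -expRD -[RHS](@expR0 R); congr expR; lra.
by have := expR_gt0 (1 : R); nra.
Qed.

Lemma expR1_ge : 27 / 10 <= expR 1 :> R.
Proof.
have := @expR_ge_taylor 6 1 ler01.
rewrite !big_ord_recr big_ord0/= add0r !expr1n !factS fact0 /=.
by move/(le_trans _); apply; lra.
Qed.

Lemma sin_lex x : 0 <= x -> sin x <= x.
Proof.
move=> x0; rewrite -subr_ge0.
pose f := fun t : R => t - sin t.
have : f 0 <= f x.
  apply: (@is_derive_ge0_le _ (fun t => 1 - cos t) _ _ x0) => t _.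
  by have := cos_le1 t; lra.
by rewrite /f sin0 subrr.
Qed.

End Calculus.

(** * Wallis' integrals and Stirling's lower bound *)

Section Wallis.
Context {R : realType}.
Implicit Types (x : R).

(** [pi / 12 >= sin (pi / 12)], and [sin (pi / 12) ^+ 2 = (1 - cos (pi / 6)) / 2]
    with [cos (pi / 6) ^+ 2 = 3 / 4], which follows from [cos (3 * (pi / 6)) = 0]. *)
Lemma pi_ge31 : (31 / 10) <= pi :> R.
Proof.
pose c : R := cos (pi / 6); pose s : R := sin (pi / 12).
have pi0 : 0 < pi :> R := pi_gt0 R.
have c0 : 0 < c by apply: cos_gt0_pihalf; lra.
have cE : c = 1 - 2 * s ^+ 2.
  have -> : c = cos ((pi / 12) *+ 2) by congr cos; rewrite -mulr_natr; field.
  by rewrite cos_mulr2n cos2sin2 -/s -mulr_natr; ring.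
have c3 : c * (4 * c ^+ 2 - 3) = 0.
  have : cos (pi / 6 + (pi / 6) *+ 2) = 0 :> R.
    by rewrite -[RHS](@cos_pihalf R); congr cos; rewrite -mulr_natr; field.
  rewrite cosD cos_mulr2n sin_mulr2n -/c => h.
  have := sin2cos2 (pi / 6 : R); rewrite -/c => h2; rewrite -[RHS]h.
  by rewrite !mulr2n; set s6 := sin _ in h2 *; have := congr1 ( *%R c) h2; lra.
have {}c3 : c ^+ 2 = 3 / 4.
  by move/eqP: c3; rewrite mulf_eq0 gt_eqF//= => /eqP; lra.
have s_le : s <= pi / 12 by apply: sin_lex; lra.
have s_ge : 0 <= s by apply: sin_ge0_pi; lra.
(* 97 / 112 is a close rational upper bound of sqrt 3 / 2 *)
have c_le : c <= 97 / 112 by nra.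
have : 31 / 120 <= s by nra.
by lra.
Qed.

(** An explicit primitive of [sin ^+ n], by the reduction formula; it makes
    Wallis' integrals available with the mean value theorem alone. *)
Fixpoint sin_exp_primitive n x : R :=
  match n with
  | 0 => x
  | 1 => 1 - cos x
  | m.+2 => (m.+1%:R * sin_exp_primitive m x - sin x ^+ m.+1 * cos x) / m.+2%:R
  end.

Lemma is_derive_sin_exp_primitive n x :
  is_derive x 1 (sin_exp_primitive n) (sin x ^+ n).
Proof.
elim/ltn_ind: n x => -[|[|n]] IH x.
- exact: is_derive_id.
- by apply: is_derive_eq; rewrite expr1; ring.
have IHn := IH n (leqnSn _) x.
have n2 : n.+2%:R != 0 :> R by rewrite pnatr_eq0.
have -> : sin_exp_primitive n.+2 = n.+2%:R^-1 *:
    (n.+1%:R *: sin_exp_primitive n - (sin ^+ n.+1) * cos).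
  by apply/funext => y; rewrite /= !fctE mulrC.
apply: is_derive_eq.
rewrite /GRing.scale/= fctE; apply: (mulfI n2); rewrite (mulVKf n2).
rewrite !exprS -[n.+2%:R]natr1; move: (cos2sin2 x) (sin x ^+ n) (n.+1%:R : R).
move=> c2 S N; have := congr1 ( *%R (N * S)) c2; rewrite !expr2; lra.
Qed.

Lemma sin_exp_primitive0 n : sin_exp_primitive n 0 = 0.
Proof.
elim/ltn_ind: n => -[|[|n]] IH //=; first by rewrite cos0 subrr.
by rewrite IH// sin0 expr0n/= mulr0 mul0r subrr mul0r.
Qed.

Definition wallis n : R := sin_exp_primitive n (pi / 2).

Lemma wallis0 : wallis 0 = pi / 2. Proof. by []. Qed.

Lemma wallis1 : wallis 1 = 1.
Proof. by rewrite /wallis/= cos_pihalf subr0. Qed.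

Lemma wallisSS n : n.+2%:R * wallis n.+2 = n.+1%:R * wallis n.
Proof.
rewrite /wallis/= cos_pihalf mulr0 subr0 mulrC divfK//.
Qed.

Lemma wallis_gt0 n : 0 < wallis n.
Proof.
elim/ltn_ind: n => -[|[|n]] IH.
- by rewrite wallis0 divr_gt0// pi_gt0.
- by rewrite wallis1.
by rewrite -(pmulr_rgt0 _ (ltr0Sn R n.+1)) wallisSS mulr_gt0// IH.
Qed.

(** The primitive of [sin ^+ n - sin ^+ n.+1 >= 0] is nondecreasing. *)
Lemma wallis_le n : wallis n.+1 <= wallis n.
Proof.
rewrite -subr_ge0.
pose f := sin_exp_primitive n - sin_exp_primitive n.+1.
have pi2 : 0 <= pi / 2 :> R by rewrite divr_ge0// pi_ge0.
suff : f 0 <= f (pi / 2) by rewrite /f !fctE !sin_exp_primitive0 subrr.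
apply: (@is_derive_ge0_le _ _ (fun x => sin x ^+ n - sin x ^+ n.+1) _ _ pi2) => x.
  have h1 := is_derive_sin_exp_primitive n x.
  have h2 := is_derive_sin_exp_primitive n.+1 x.
  by move=> _; apply: is_derive_eq.
rewrite in_itv/= => /andP[x0 xpi].
have s0 : 0 <= sin x by apply: sin_ge0_pi; lra.
by rewrite subr_ge0 exprS ler_piMl ?exprn_ge0 ?sin_le1.
Qed.

Lemma wallis_mul n : n.+1%:R * (wallis n.+1 * wallis n) = pi / 2.
Proof.
elim: n => [|n IH]; first by rewrite wallis0 wallis1 !mul1r.
by rewrite mulrA wallisSS -IH -mulrA [wallis n * _]mulrC.
Qed.

Lemma wallis_even k :
  wallis k.*2 * (4 ^+ k * k`!%:R ^+ 2) = pi / 2 * (k.*2)`!%:R.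
Proof.
elim: k => [|k IH]; first by rewrite wallis0 expr0 fact0 expr1n !mulr1.
rewrite doubleS !factS !natrM exprS.
have -> : pi / 2 * (k.*2.+2%:R * (k.*2.+1%:R * (k.*2)`!%:R)) =
  k.*2.+2%:R * (k.*2.+1%:R * (wallis k.*2 * (4 ^+ k * k`!%:R ^+ 2))) :> R.
  by rewrite IH; ring.
rewrite (_ : k.*2.+1%:R * (wallis k.*2 * _) =
   (k.*2.+2%:R * wallis k.*2.+2) * (4 ^+ k * k`!%:R ^+ 2)); last first.
  by rewrite wallisSS mulrA.
have -> : k.*2.+2%:R = 2 * k.+1%:R :> R by rewrite -doubleS -mul2n natrM.
by ring.
Qed.

(** Wallis' bound [C(2k, k) <= 4 ^ k / sqrt (pi k)], cleared of denominators: by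
    [wallis_le] and [wallis_mul], [2 k wallis (2 k) ^ 2] is at most [pi / 2]. *)
Lemma central_binomial_le k :
  pi * k%:R * (k.*2)`!%:R ^+ 2 <= (4 ^+ k * k`!%:R ^+ 2) ^+ 2 :> R.
Proof.
case: k => [|k]; first by rewrite mulr0 mul0r sqr_ge0.
set F := (k.+1.*2)`!%:R; set K := 4 ^+ k.+1 * _.
have wE : wallis k.+1.*2 * K = pi / 2 * F by exact: wallis_even.
have := wallis_mul k.*2.+1; rewrite -doubleS.
have := wallis_le k.*2.+1; rewrite -doubleS.
have := wallis_gt0 k.+1.*2; have := pi_gt0 R.
have -> : k.+1.*2%:R = 2 * k.+1%:R :> R by rewrite -mul2n natrM.
move: wE; move: (wallis k.+1.*2) (wallis k.*2.+1) (k.+1%:R : R) (ler0n R k.+1).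
move=> w w' a a0 wE pi0 w0 ww' awE.
have h : 2 * a * w ^+ 2 <= pi / 2.
  by rewrite -awE expr2 ler_wpM2l ?ler_wpM2l ?(ltW w0)//; lra.
have : 2 * a * (w * K) ^+ 2 <= pi / 2 * K ^+ 2.
  by rewrite exprMn mulrA ler_wpM2r ?sqr_ge0.
rewrite wE => h2; rewrite -(ler_pM2l (_ : 0 < pi / 2)) ?divr_gt0//.
by apply: le_trans h2; rewrite le_eqVlt; apply/orP; left; apply/eqP; field.
Qed.

(** The square of the quotient of [k`!] by Stirling's approximation. *)
Let sigma k : R := (k`!%:R * expR k%:R / k%:R ^+ k) ^+ 2 / (2 * pi * k%:R).

Let sigma_gt0 k : (0 < k)%N -> 0 < sigma k.
Proof.
move=> k0; have pi0 := pi_gt0 R.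
have kR0 : 0 < k%:R :> R by rewrite ltr0n.
have fk0 : 0 < k`!%:R :> R by rewrite ltr0n fact_gt0.
by rewrite !(divr_gt0, mulr_gt0, exprn_gt0)// expR_gt0.
Qed.

(** This is [central_binomial_le] rewritten in terms of [sigma]. *)
Let sigma_double k : (0 < k)%N -> sigma k.*2 <= sigma k ^+ 2.
Proof.
move=> k0; have pi0 := pi_gt0 R.
have := central_binomial_le k.
have k2E : k.*2%:R = 2 * k%:R :> R by rewrite -mul2n natrM.
have expE : k.*2%:R ^+ k.*2 = 4 ^+ k * (k%:R ^+ k) ^+ 2 :> R.
  rewrite k2E -mul2n mulnC exprM exprMn exprMn; congr (_ * _).
  by rewrite -exprM mulnC exprM; congr (_ ^+ _); rewrite -natrX.
rewrite /sigma expE k2E expRM_natl.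
have e0 := expR_gt0 (k%:R : R).
have : 0 < k%:R :> R by rewrite ltr0n.
have : 0 < k%:R ^+ k :> R by rewrite exprn_gt0// ltr0n.
have : 0 < 4 ^+ k :> R by rewrite exprn_gt0.
have : pi != 0 :> R by rewrite gt_eqF.
move: (pi : R) pi0 => p _.
move: e0; move: (k%:R : R) (k`!%:R : R) ((k.*2)`!%:R : R) (4 ^+ k : R) (k%:R ^+ k : R) (expR _).
move=> a f g F K e e0 p0 F0 K0 a0 h.
have -> : (g * e ^+ 2 / (F * K ^+ 2)) ^+ 2 / (2 * p * (2 * a)) =
   (e ^+ 2 / (F * K ^+ 2 * (2 * p * a))) ^+ 2 * (p * a * g ^+ 2).
  by field; rewrite p0 !gt_eqF.
have -> : ((f * e / K) ^+ 2 / (2 * p * a)) ^+ 2 =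
   (e ^+ 2 / (F * K ^+ 2 * (2 * p * a))) ^+ 2 * (F * f ^+ 2) ^+ 2.
  by field; rewrite p0 !gt_eqF.
by rewrite ler_wpM2l ?sqr_ge0.
Qed.

Let sigma_ge k : (0 < k)%N -> (2 * pi * k%:R)^-1 <= sigma k.
Proof.
move=> k0; have pi0 := pi_gt0 R.
rewrite /sigma ler_peMl ?invr_ge0 ?mulr_ge0// ?(ltW pi0)//.
rewrite exprn_ege1// ler_pdivlMr ?exprn_gt0 ?ltr0n// mul1r.
have := @expR_ge_taylor R k.+1 k%:R (ler0n _ _).
rewrite big_ord_recr/= => h.
rewrite mulrC -ler_pdivrMr ?ltr0n ?fact_gt0//; apply: le_trans h.
by rewrite lerDr sumr_ge0// => i _; rewrite divr_ge0 ?exprn_ge0.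
Qed.

Let sigma_iter k j : (0 < k)%N -> sigma (k * 2 ^ j) <= sigma k ^+ (2 ^ j).
Proof.
move=> k0; elim: j => [|j IH]; first by rewrite expn0 muln1 expr1.
have kj : (0 < k * 2 ^ j)%N by rewrite muln_gt0 k0 expn_gt0.
rewrite expnSr mulnA muln2; apply: le_trans (sigma_double kj) _.
by rewrite exprM lerXn2r ?nnegrE ?exprn_ge0 ?(ltW (sigma_gt0 _)).
Qed.

(** If [sigma k < 1], then [sigma_double] makes [sigma (k * 2 ^ j)] decay like
    [sigma k ^+ (2 ^ j)], which contradicts the crude polynomial lower bound
    [sigma_ge]. *)
Lemma stirling_le k : 2 * pi * k%:R * (k%:R ^+ k) ^+ 2 <= (k`!%:R * expR k%:R) ^+ 2 :> R.
Proof.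
case: (posnP k) => [->|k0]; first by rewrite mulr0 mul0r sqr_ge0.
have pi0 := pi_gt0 R.
have kR0 : 0 < k%:R :> R by rewrite ltr0n.
suff : 1 <= sigma k.
  rewrite /sigma ler_pdivlMr ?mulr_gt0// mul1r expr_div_n.
  by rewrite ler_pdivlMr ?exprn_gt0.
rewrite leNgt; apply/negP => s1.
have s0 := sigma_gt0 k0.
pose y := (sigma k)^-1; have y0 : 0 < y by rewrite invr_gt0.
have y1 : 1 < y by rewrite invf_gt1.
(* along the powers of 2, y ^ (2 m) grows at most linearly in m *)
have ym j : y ^+ (2 ^ j).*2 <= 4 * pi * k%:R * (2 ^ j)%:R.
  have := sigma_iter j.+1 k0.
  have kj : (0 < k * 2 ^ j.+1)%N by rewrite muln_gt0 k0 expn_gt0.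
  move/(le_trans (sigma_ge kj)).
  rewrite -[X in _ <= X -> _]invrK lef_pV2 ?posrE ?invr_gt0 ?exprn_gt0//; last first.
    by rewrite !mulr_gt0// ltr0n.
  rewrite -exprVn -/y -muln2 -expnSr => /le_trans; apply.
  by rewrite natrM expnS natrM le_eqVlt; apply/orP; left; apply/eqP; ring.
have bern m : 1 + m%:R * (y - 1) <= y ^+ m.
  elim: m => [|m IH]; first by rewrite mul0r addr0.
  have m0 : 0 <= m%:R * (y - 1) ^+ 2 :> R by rewrite mulr_ge0 ?sqr_ge0.
  have := ler_wpM2l (ltW y0) IH; rewrite exprS -[m.+1%:R]natr1; lra.
have mle j : (2 ^ j)%:R * (y - 1) ^+ 2 <= 4 * pi * k%:R.
  have m0 : 0 < (2 ^ j)%:R :> R by rewrite ltr0n expn_gt0.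
  rewrite -(ler_pM2l m0) [leRHS]mulrC; apply: le_trans (ym j).
  rewrite -muln2 exprM mulrA -expr2 -exprMn.
  rewrite lerXn2r ?nnegrE ?exprn_ge0 ?mulr_ge0 ?(ltW y0) ?subr_ge0 ?(ltW y1)//.
  by apply: le_trans (bern _); rewrite lerDr.
pose z := 4 * pi * k%:R / (y - 1) ^+ 2.
have y2 : 0 < (y - 1) ^+ 2 by rewrite exprn_gt0// subr_gt0.
have z0 : 0 <= z by rewrite divr_ge0 ?(ltW y2)// !mulr_ge0// ltW.
have := archi_boundP z0; rewrite ltNge => /negP; apply.
rewrite ler_pdivlMr//; apply: le_trans (mle (Num.bound z)).
by rewrite ler_wpM2r ?(ltW y2)// ler_nat ltnW// ltn_expl.
Qed.
End Wallis.

(** * Upper bounds for single Poisson probabilities *)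

Section PoissonPeaks.
Context {R : realType}.
Implicit Types (lam x y z : R) (k m b : nat).

Lemma poisson_pmfE lam k : 0 < lam ->
  poisson_pmf lam k = lam ^+ k / k`!%:R * expR (- lam).
Proof. by rewrite /poisson_pmf => ->. Qed.

(** Stirling's formula for [k`!], squared to keep square roots away. *)
Lemma poisson_sqr_le lam k : 0 < lam -> (0 < k)%N ->
  poisson_pmf lam k ^+ 2 * (2 * pi * k%:R)
  <= ((lam / k%:R) ^+ k * expR (k%:R - lam)) ^+ 2.
Proof.
move=> lam0 k0; have kR0 : 0 < k%:R :> R by rewrite ltr0n.
have fk0 : 0 < k`!%:R :> R by rewrite ltr0n fact_gt0.
have := @stirling_le R k.
rewrite poisson_pmfE// expRD.
have K0 : 0 < k%:R ^+ k :> R by rewrite exprn_gt0.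
rewrite expr_div_n.
have E0 := expR_gt0 (k%:R : R).
move: K0 (expR_gt0 (- lam)) E0 (pi_gt0 R).
move: (lam ^+ k) (expR (- lam)) (expR (k%:R : R)) (k`!%:R : R) fk0 (k%:R ^+ k : R) => L e E f f0 K.
move=> K0 e0 E0 pi0 h.
have -> : (L / f * e) ^+ 2 * (2 * pi * k%:R) =
  (L * e / (f * K)) ^+ 2 * (2 * pi * k%:R * K ^+ 2).
  by field; rewrite !gt_eqF.
have -> : (L / K * (E * e)) ^+ 2 = (L * e / (f * K)) ^+ 2 * (f * E) ^+ 2.
  by field; rewrite !gt_eqF.
by rewrite ler_wpM2l ?sqr_ge0.
Qed.

(** The bound [ln (1 - y) <= - y - y ^ 2 / 2]; on [0, 1] it follows from the cubic
    Taylor polynomial of the exponential at [- (y + y ^ 2 / 2)]. *)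
Lemma onem_le_expR y : 0 <= y <= 1 -> 1 - y <= expR (- (y + y ^+ 2 / 2)).
Proof.
move=> /andP[y0 y1]; apply: le_trans (expR_ge_cubic _).
set u := y + _.
have : u ^+ 3 / 6 <= y ^+ 3 / 2 + y ^+ 4 / 8.
  have -> : u ^+ 3 / 6 = y ^+ 3 * ((1 + y / 2) ^+ 3 / 6) by rewrite /u; field.
  have -> : y ^+ 3 / 2 + y ^+ 4 / 8 = y ^+ 3 * (1 / 2 + y / 8) by field.
  by rewrite ler_wpM2l ?exprn_ge0//; nra.
rewrite (_ : (- u) ^+ 3 = - u ^+ 3); last by ring.
rewrite (_ : (- u) ^+ 2 = u ^+ 2); last by ring.
by rewrite {2 3}/u; lra.
Qed.

(** [ln (1 + y)] is at most its Pade approximant [y (6 + y) / (6 + 4 y)]; after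
    expansion of the exponential to order 4, the difference is a quotient of
    polynomials with nonnegative coefficients. *)
Lemma onep_le_expR y : 0 <= y ->
  1 + y <= expR (y * (6 + y) / (6 + 4 * y)).
Proof.
move=> y0.
have D0 : 0 < 6 + 4 * y by lra.
have := @expR_ge_taylor R 5 (y * (6 + y) / (6 + 4 * y)).
rewrite divr_ge0 ?mulr_ge0 ?(ltW D0)//; last by lra.
move/(_ isT); apply: le_trans.
rewrite !big_ord_recr big_ord0/= add0r expr0 expr1 !factS fact0 /= !mul1n !muln1.
rewrite -subr_ge0.
set e := (X in 0 <= X).
have -> : e = (36 * y ^+ 4 + 54 * y ^+ 5 + 30 * y ^+ 6 + 5 / 3 * y ^+ 7 + y ^+ 8 / 24)
   / (6 + 4 * y) ^+ 4.
  by rewrite /e; field; rewrite gt_eqF.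
by rewrite divr_ge0 ?exprn_ge0// ?(ltW D0)//; rewrite !addr_ge0 ?mulr_ge0 ?divr_ge0 ?exprn_ge0//.
Qed.

Lemma mul_expRN_le z : z * expR (- z) <= expR (- 1).
Proof.
have := expR_ge1Dx (z - 1); rewrite addrC subrK => h.
have -> : expR (- 1) = expR (z - 1) * expR (- z) :> R by rewrite -expRD; congr expR; ring.
by rewrite ler_wpM2r ?expR_ge0.
Qed.

Lemma ler_of_sqr x y : 0 <= y -> x ^+ 2 <= y ^+ 2 -> x <= y.
Proof.
move=> y0 h; rewrite (le_trans (ler_norm x))// -(ger0_norm y0).
by rewrite -ler_sqr ?nnegrE// !real_normK ?num_real.
Qed.

(** With [y = (b - lam) / b] and [z = b y ^ 2], Stirling's formula and
    [onem_le_expR] bound the square of the left side by [z e^-z / (2 pi)], hence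
    by [1 / (2 pi e)]; the constant is a rational number above its root. *)
Lemma poisson_right_le lam b : 0 < lam ->
  poisson_pmf lam b * (b%:R - lam) <= 489 / 2000.
Proof.
move=> lam0.
have [bl|lb] := leP b%:R lam.
  have p0 := poisson_pmf_ge0 lam b.
  by apply: (@le_trans _ _ 0); [rewrite mulr_ge0_le0// subr_le0|lra].
have b0 : (0 < b)%N by rewrite -(ltr0n R); apply: lt_trans lb.
have bR0 : 0 < b%:R :> R by rewrite ltr0n.
apply: ler_of_sqr; first by lra.
pose y := (b%:R - lam) / b%:R.
have y0 : 0 <= y by rewrite divr_ge0 ?subr_ge0 ?ltW.
have y1 : y <= 1 by rewrite ler_pdivrMr// mul1r gerBl ltW.
have lamE : lam / b%:R = 1 - y by rewrite /y; field; rewrite gt_eqF.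
have byE : b%:R - lam = b%:R * y by rewrite /y; field; rewrite gt_eqF.
have := poisson_sqr_le lam0 b0; rewrite lamE byE.
set p := poisson_pmf lam b => h.
have {}h : p ^+ 2 * (2 * pi * b%:R) <= expR (- (b%:R * y ^+ 2)).
  apply: le_trans h _.
  have -> : - (b%:R * y ^+ 2) = (b%:R * - (y + y ^+ 2 / 2) + b%:R * y) * 2%:R by field.
  rewrite expRM_natr lerXn2r ?nnegrE ?mulr_ge0 ?exprn_ge0 ?expR_ge0 ?subr_ge0//.
  rewrite expRD ler_wpM2r ?expR_ge0// expRM_natl lerXn2r ?nnegrE ?expR_ge0 ?subr_ge0//.
  by rewrite onem_le_expR// y0.
have {}h : (p * (b%:R * y)) ^+ 2 * (2 * pi) <= expR (- 1).
  apply: le_trans (mul_expRN_le (b%:R * y ^+ 2)).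
  have -> : (p * (b%:R * y)) ^+ 2 * (2 * pi) = b%:R * y ^+ 2 * (p ^+ 2 * (2 * pi * b%:R)).
    by ring.
  by rewrite ler_wpM2l// mulr_ge0 ?sqr_ge0 ?ltW.
have e1 : expR (- 1) <= 10 / 27 :> R.
  have := @expR1_ge R; rewrite expRN => e1.
  by rewrite -[leRHS]invrK lef_pV2 ?posrE ?expR_gt0//; lra.
have := @pi_ge31 R; have := sqr_ge0 (p * (b%:R * y)).
by move: ((p * (b%:R * y)) ^+ 2) h => s h s0 pi31; nra.
Qed.

(** With [y = (lam - m) / m], [t = 2 y / 3] and [w = m y ^ 2 / (1 + t)],
    Stirling's formula and [onep_le_expR] bound the square of the left side by
    [w (1 + t) e^-w / (2 pi)]. The condition [3 <= m] keeps [t] small enough for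
    [w (1 + t) e^-w <= 0.57]. *)
Lemma poisson_left_le lam m : 0 < lam -> (3 <= m)%N ->
  poisson_pmf lam m * (lam - m%:R) <= 607 / 2000.
Proof.
move=> lam0 m3.
have [bl|lb] := leP lam m%:R.
  have p0 := poisson_pmf_ge0 lam m.
  by apply: (@le_trans _ _ 0); [rewrite mulr_ge0_le0// subr_le0|lra].
have b0 : (0 < m)%N by lia.
have bR3 : 3 <= m%:R :> R by rewrite (ler_nat R 3 m).
have bR0 : 0 < m%:R :> R by rewrite ltr0n.
apply: ler_of_sqr; first by lra.
pose y := (lam - m%:R) / m%:R.
have y0 : 0 <= y by rewrite divr_ge0 ?subr_ge0 ?ltW.
have lamE : lam / m%:R = 1 + y by rewrite /y; field; rewrite gt_eqF.
have byE : lam - m%:R = m%:R * y by rewrite /y; field; rewrite gt_eqF.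
have byE' : m%:R - lam = - (m%:R * y) by rewrite -byE opprB.
have := poisson_sqr_le lam0 b0; rewrite lamE byE' byE.
set p := poisson_pmf lam m => h.
pose t := 2 * y / 3; have t0 : 0 <= t by rewrite /t; lra.
have t1 : 0 < 1 + t by lra.
pose w := m%:R * y ^+ 2 / (1 + t).
have w0 : 0 <= w by rewrite divr_ge0 ?(ltW t1)// mulr_ge0 ?sqr_ge0 ?(ltW bR0).
have wE : m%:R * y ^+ 2 = w * (1 + t) by rewrite /w divfK// gt_eqF.
have {}h : p ^+ 2 * (2 * pi * m%:R) <= expR (- w).
  apply: le_trans h _.
  have -> : - w = (m%:R * (y * (6 + y) / (6 + 4 * y)) - m%:R * y) * 2%:R.
    by rewrite /w /t; field; rewrite !gt_eqF//; lra.
  rewrite expRM_natr lerXn2r ?nnegrE ?mulr_ge0 ?exprn_ge0 ?expR_ge0 ?addr_ge0//.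
  rewrite expRD ler_wpM2r ?expR_ge0// expRM_natl lerXn2r ?nnegrE ?expR_ge0 ?addr_ge0//.
  exact: onep_le_expR.
have {}h : (p * (m%:R * y)) ^+ 2 * (2 * pi) <= w * (1 + t) * expR (- w).
  rewrite -wE.
  have -> : (p * (m%:R * y)) ^+ 2 * (2 * pi) = m%:R * y ^+ 2 * (p ^+ 2 * (2 * pi * m%:R)).
    by ring.
  by rewrite ler_wpM2l// mulr_ge0 ?sqr_ge0 ?ltW.
(* 27 t^2 / 4 = 3 y^2 <= w (1 + t) bounds t by a line in w; the line is close to
   the tangent at w = 1.2, near which w (1 + t) e^-w is largest. *)
have tw : t <= 21 / 100 + 262 / 1000 * w.
  have : 27 / 4 * t ^+ 2 <= w * (1 + t) by rewrite -wE /t; have := ler_wpM2r (sqr_ge0 y) bR3; lra.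
  rewrite leNgt => htw; apply/negP => tw.
  have : 0 < (t - (21 / 100 + 262 / 1000 * w)) *
             (27 / 4 * (t + (21 / 100 + 262 / 1000 * w)) - w).
    by apply: mulr_gt0; lra.
  by have := sqr_ge0 (w - 117 / 100); lra.
have ew : w * (1 + t) <= 57 / 100 * expR w.
  have := @expR_ge_taylor R 5 w w0.
  rewrite !big_ord_recr big_ord0/= add0r expr0 expr1 !factS fact0 /= !mul1n !muln1 => ew.
  have : w * (1 + t) <= w * (121 / 100 + 262 / 1000 * w) by rewrite ler_wpM2l//; lra.
  have := sqr_ge0 (w ^+ 2 - 144 / 100); have := sqr_ge0 (w - 122 / 100).
  have : 0 <= w * (w - 12 / 10) ^+ 2 by rewrite mulr_ge0 ?sqr_ge0.
  lra.
have {}h : (p * (m%:R * y)) ^+ 2 * (2 * pi) <= 57 / 100.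
  apply: le_trans h _.
  rewrite [leRHS](_ : _ = 57 / 100 * expR w * expR (- w)); last first.
    by rewrite -mulrA expRxMexpNx_1 mulr1.
  by rewrite ler_wpM2r ?expR_ge0.
have := @pi_ge31 R; have := sqr_ge0 (p * (m%:R * y)).
by move: ((p * (m%:R * y)) ^+ 2) h => s h s0 pi31; nra.
Qed.
End PoissonPeaks.

(** * The extremal inequality for the second Charlier polynomial *)

Section Charlier.
Context {R : realType}.
Implicit Types (lam x : R) (k m b : nat).

(** The second Charlier polynomial of the Poisson law, normalized so that
    [poisson_pmf lam k * charlier2 lam k] is [lam ^+ 2] times the second
    backward difference of [poisson_pmf lam] at [k]. *)
Definition charlier2 lam k : R := k%:R ^+ 2 - (2 * lam + 1) * k%:R + lam ^+ 2.

(** Multiplying by [expR lam] turns bounds by a multiple of [1 / e] into bounds by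
    [expR (lam - 1)], which Taylor polynomials at [lam = 1] can handle. *)
Let scaled_le lam x y : x <= y * expR (lam - 1) -> x * expR (- lam) <= y * expR (- 1).
Proof.
have -> : expR (- 1) = expR (lam - 1) * expR (- lam) :> R.
  by rewrite -expRD; congr expR; ring.
by move=> h; rewrite mulrA ler_wpM2r ?expR_ge0.
Qed.

Let poisson_pair_le lam m b : 0 < lam ->
  lam ^+ m / m`!%:R * (lam - m%:R) + lam ^+ b / b`!%:R * (b%:R - lam)
    <= 3 / 2 * expR (lam - 1) ->
  poisson_pmf lam m * (lam - m%:R) + poisson_pmf lam b * (b%:R - lam)
    <= 3 / 2 * expR (- 1).
Proof.
move=> lam0 /scaled_le; rewrite !poisson_pmfE//; apply: le_trans.
by rewrite le_eqVlt; apply/orP; left; apply/eqP; ring.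
Qed.

(** For [b = 2] both sides have the same value and slope at [lam = 1]: this is the
    case of equality of the whole estimate. *)
Let pair_small lam b : 0 < lam -> lam < 2 -> (0 < b <= 3)%N ->
  lam + lam ^+ b / b`!%:R * (b%:R - lam) <= 3 / 2 * expR (lam - 1).
Proof.
move=> lam0 lam2 b03; have h := expR_ge_cubic (lam - 1).
suff : lam + lam ^+ b / b`!%:R * (b%:R - lam) <=
    3 / 2 * (1 + (lam - 1) + (lam - 1) ^+ 2 / 2 + (lam - 1) ^+ 3 / 6).
  by lra.
pose x := lam - 1; have lamE : lam = 1 + x by rewrite /x; ring.
have {lam0} x1 : -1 < x by rewrite /x; lra.
have {lam2} x2 : x < 1 by rewrite /x; lra.
rewrite {h}lamE {lamE}; move: x x1 x2 => x x1 x2.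
case: b b03 => [|[|[|[|//]]]]// _; rewrite !factS fact0.
- have := sqr_ge0 (x + 1 / 2).
  have : 0 <= (1 + x) ^+ 3 by rewrite exprn_ge0//; lra.
  nra.
- have : 0 <= x ^+ 2 * (5 + 3 * x) by rewrite mulr_ge0 ?sqr_ge0//; lra.
  nra.
- have : 0 <= (1 + x) * (x - 1 / 3) ^+ 2 by rewrite mulr_ge0 ?sqr_ge0//; lra.
  have := sqr_ge0 (x ^+ 2); have := sqr_ge0 (x - 1 / 2).
  nra.
Qed.

(** Here there is room to spare, and the exponential may be expanded at
    [lam = 2], with 27 / 10 in place of e. *)
Let pair_medium lam b : 2 <= lam -> (2 <= b <= 5)%N ->
  lam * (lam - 1) + lam ^+ b / b`!%:R * (b%:R - lam) <= 3 / 2 * expR (lam - 1).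
Proof.
move=> lam2 b25.
have h : 27 / 10 * expR (lam - 2) <= expR (lam - 1).
  have -> : expR (lam - 1) = expR 1 * expR (lam - 2) by rewrite -expRD; congr expR; ring.
  by rewrite ler_wpM2r ?expR_ge0// expR1_ge.
have h' := expR_ge_cubic (lam - 2).
suff : lam * (lam - 1) + lam ^+ b / b`!%:R * (b%:R - lam) <= 3 / 2 * (27 / 10 *
    (1 + (lam - 2) + (lam - 2) ^+ 2 / 2 + (lam - 2) ^+ 3 / 6)).
  by lra.
pose t := lam - 2; have lamE : lam = 2 + t by rewrite /t; ring.
have {lam2} t0 : 0 <= t by rewrite /t; lra.
rewrite {h h'}lamE {lamE}; move: t t0 => t t0.
have t2 : 0 <= t ^+ 2 by rewrite exprn_ge0.
have t3 : 0 <= t ^+ 3 by rewrite exprn_ge0.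
have t4 : 0 <= t ^+ 4 by rewrite exprn_ge0.
have t5 : 0 <= t ^+ 5 by rewrite exprn_ge0.
have t6 : 0 <= t ^+ 6 by rewrite exprn_ge0.
case: b b25 => [|[|[|[|[|[|//]]]]]]// _; rewrite !factS fact0.
- by lra.
- by lra.
- have := sqr_ge0 (t - 1 / 2).
  have : 0 <= t * (t - 1 / 2) ^+ 2 by rewrite mulr_ge0 ?sqr_ge0.
  by lra.
- have := sqr_ge0 (t - 137 / 100).
  have : 0 <= t * (t - 1) ^+ 2 by rewrite mulr_ge0 ?sqr_ge0.
  by lra.
Qed.

(** The maximum over [lam] is [16 / e ^ 4], attained at [lam = 4]. *)
Let poisson_left2_le lam : 262 / 100 <= lam ->
  poisson_pmf lam 2 * (lam - 2) <= 607 / 2000.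
Proof.
move=> lam2; have lam0 : 0 < lam by lra.
have h : 53 * expR (lam - 4) <= expR lam.
  have -> : expR lam = expR 1 ^+ 4 * expR (lam - 4).
    by rewrite -expRM_natl -expRD; congr expR; ring.
  rewrite ler_wpM2r ?expR_ge0//; have e1 := @expR1_ge R.
  have e2 : 729 / 100 <= expR 1 ^+ 2 :> R by nra.
  by rewrite (_ : expR 1 ^+ 4 = (expR 1 ^+ 2) ^+ 2); [nra|ring].
have h' := expR_ge_cubic (lam - 4).
rewrite poisson_pmfE// !factS fact0.
suff : lam ^+ 2 / 2 * (lam - 2) <= 607 / 2000 * expR lam.
  move=> hh; have := ler_wpM2r (expR_ge0 (- lam)) hh.
  by rewrite -(mulrA (607 / 2000)) expRxMexpNx_1; lra.
suff : lam ^+ 2 / 2 * (lam - 2) <= 607 / 2000 * (53 *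
   (1 + (lam - 4) + (lam - 4) ^+ 2 / 2 + (lam - 4) ^+ 3 / 6)) by lra.
pose t := lam - 4; have lamE : lam = 4 + t by rewrite /t; ring.
have {lam2 lam0} t0 : - 138 / 100 <= t by rewrite /t; lra.
rewrite {h h'}lamE {lamE}; move: t t0 => t t0.
have : 0 <= t ^+ 2 * (t + 138 / 100) by rewrite mulr_ge0 ?sqr_ge0//; lra.
have := sqr_ge0 (t + 138 / 100).
by have := sqr_ge0 t; nra.
Qed.

(** The hypotheses say that the negative values of [charlier2 lam] right after [m]
    extend to [b]; they confine [b] to [b <= 3] for [m = 0] and to [b <= 5] for
    [m = 1]. For [m >= 2] the separate bounds add up to
    [607 / 2000 + 489 / 2000 < 3 / (2 e)]. *)
Lemma poisson_extremal_le lam m b : 0 < lam ->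
  (forall k, (k <= m)%N -> 0 <= charlier2 lam k) ->
  (forall k, (m < k <= b)%N -> charlier2 lam k < 0) -> (m < b)%N ->
  poisson_pmf lam m * (lam - m%:R) + poisson_pmf lam b * (b%:R - lam)
    <= 3 / 2 * expR (- 1).
Proof.
move=> lam0 Qm Qb mb.
have b_le k : (m < k)%N -> 0 <= charlier2 lam k -> (b < k)%N.
  move=> mk; rewrite leNgt ltnNge; apply: contra => kb.
  by apply: Qb; rewrite mk.
have Qm1 := Qb m.+1; rewrite ltnSn mb /charlier2 in Qm1; have {}Qm1 := Qm1 isT.
have [lam2|lam2] := ltP lam 2.
  have m0 : m = 0%N.
    apply/eqP; rewrite -leqn0 leqNgt; apply/negP => m0.
    by have := Qm 1%N m0; rewrite /charlier2; nra.
  subst m; apply: poisson_pair_le => //.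
  rewrite expr0 fact0 divr1 mul1r subr0; apply: pair_small => //.
  rewrite mb; apply: (b_le 4) => //; rewrite /charlier2.
  suff : 0 <= (2 - lam) * (6 - lam) by nra.
  by rewrite mulr_ge0//; lra.
case: m => [|[|[|m]]] in Qm Qb mb b_le Qm1 *.
- by exfalso; nra.
- apply: poisson_pair_le => //.
  rewrite expr1 divr1; apply: pair_medium => //.
  rewrite mb; apply: (b_le 6) => //; rewrite /charlier2.
  have : lam <= 342 / 100 by nra.
  by nra.
- have : poisson_pmf lam 2 * (lam - 2%:R) <= 607 / 2000.
    apply: poisson_left2_le; have := Qm 2 (leqnn _); rewrite /charlier2; nra.
  have := poisson_right_le b lam0; have := @expR1_le R; have := expRxMexpNx_1 (1 : R).
  have := expR_gt0 (1 : R); have := expR_gt0 (- 1 : R).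
  by nra.
- have := poisson_left_le lam0 (isT : 3 <= m.+3)%N.
  have := poisson_right_le b lam0; have := @expR1_le R; have := expRxMexpNx_1 (1 : R).
  have := expR_gt0 (1 : R); have := expR_gt0 (- 1 : R).
  by nra.
Qed.
End Charlier.

(** * The Stein-Chen equation *)

Section PoissonSteinEquation.
Context {R : realType} (lam : R).
Context (lam0 : 0 < lam).
Implicit Types (h : nat -> R) (k j n : nat) (a b c : R).

Local Notation pmf := (poisson_pmf lam).

Lemma poisson_pmf_gt0 k : 0 < pmf k.
Proof.
by rewrite poisson_pmfE// mulr_gt0 ?expR_gt0// divr_gt0 ?exprn_gt0// ltr0n fact_gt0.
Qed.

Lemma poisson_pmf0 : pmf 0 = expR (- lam).
Proof. by rewrite poisson_pmfE// expr0 fact0 divr1 mul1r. Qed.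

Lemma poisson_pmfS k : k.+1%:R * pmf k.+1 = lam * pmf k.
Proof.
rewrite !poisson_pmfE// factS natrM exprS; have k0 : k.+1%:R != 0 :> R by rewrite pnatr_eq0.
have fk0 : k`!%:R != 0 :> R by rewrite pnatr_eq0 gtn_eqF ?fact_gt0.
by field; rewrite nat1r fk0 k0.
Qed.

Lemma cvg_series_poisson : series pmf @ \oo --> (1 : R).
Proof.
have -> : series pmf = fun n => series (exp_coeff lam) n * expR (- lam).
  apply/funext => n; rewrite /series/= mulr_suml; apply: eq_bigr => k _.
  by rewrite poisson_pmfE.
rewrite -[X in _ --> X](expRxMexpNx_1 lam); apply: cvgMr_tmp.
exact: is_cvg_series_exp_coeff.
Qed.

Definition poisson_mean h : R := limn (series (fun k => pmf k * h k)).

Lemma cvg_poisson_mean h a b : (forall k, a <= h k <= b) ->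
  series (fun k => pmf k * h k) @ \oo --> poisson_mean h.
Proof.
move=> hab.
have cvg_pos c : series (fun k => pmf k * c) @ \oo --> 1 * c.
  have -> : series (fun k => pmf k * c) = fun n => series pmf n * c.
    by apply/funext => n; rewrite /series/= mulr_suml.
  by apply: cvgMr_tmp; exact: cvg_series_poisson.
have -> : (fun k => pmf k * h k) = (fun k => pmf k * (h k - a)) + (fun k => pmf k * a).
  by apply/funext => k; rewrite fctE; ring.
suff ch : cvgn (series (fun k => pmf k * (h k - a))).
  rewrite /poisson_mean.
  rewrite (_ : (fun k => pmf k * h k) = (fun k => pmf k * (h k - a)) + (fun k => pmf k * a)).
    by apply: is_cvg_seriesD => //; apply/cvg_ex; exists (1 * a).
  by apply/funext => k; rewrite fctE; ring.
apply: (@series_le_cvg _ _ (fun k => pmf k * (b - a))).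
- by move=> k; rewrite mulr_ge0 ?(ltW (poisson_pmf_gt0 _))// subr_ge0; case/andP: (hab k).
- move=> k; rewrite mulr_ge0 ?(ltW (poisson_pmf_gt0 _))// subr_ge0.
  by case/andP: (hab k) => /le_trans; apply.
- by move=> k; rewrite ler_wpM2l ?(ltW (poisson_pmf_gt0 _))// lerD2r; case/andP: (hab k).
- by apply/cvg_ex; exists (1 * (b - a)).
Qed.

Lemma poisson_mean_unique h l :
  series (fun k => pmf k * h k) @ \oo --> l -> poisson_mean h = l.
Proof. exact: cvg_lim. Qed.

Lemma poisson_mean_affine h a b (s t : R) : (forall k, a <= h k <= b) ->
  poisson_mean (fun k => t + s * h k) = t + s * poisson_mean h.
Proof.
move=> /cvg_poisson_mean hc; apply: poisson_mean_unique.
have -> : series (fun k => pmf k * (t + s * h k)) =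
    fun n => series pmf n * t + s * series (fun k => pmf k * h k) n.
  apply/funext => n; rewrite /series/= mulr_suml mulr_sumr -big_split/=.
  by apply: eq_bigr => k _; ring.
rewrite -[X in X + _]mul1r; apply: cvgD.
  by apply: cvgMr_tmp; exact: cvg_series_poisson.
exact: cvgMl_tmp.
Qed.

Lemma poisson_psum_le h a b n : (forall k, a <= h k <= b) -> 0 <= a ->
  \sum_(k < n) pmf k * h k <= poisson_mean h.
Proof.
move=> hab a0; have /cvg_poisson_mean hc := hab.
rewrite -(big_mkord xpredT (fun k => pmf k * h k)).
apply: (nondecreasing_cvgn_le (u_ := series (fun k => pmf k * h k))); last first.
  by apply/cvg_ex; exists (poisson_mean h).
apply/nondecreasing_seqP => k; rewrite /series/= big_nat_recr//= lerDl.
rewrite mulr_ge0 ?(ltW (poisson_pmf_gt0 _))//.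
by case/andP: (hab k) => + _; apply: le_trans.
Qed.

Lemma poisson_mean_le h a b c : (forall k, a <= h k <= b) ->
  (forall n, \sum_(k < n) pmf k * h k <= c) -> poisson_mean h <= c.
Proof.
move=> /cvg_poisson_mean hc hn; apply: (cvgr_to_le hc).
by near=> n; rewrite /series/= big_mkord.
Unshelve. all: by end_near. Qed.

Definition poisson_cdf j : R := \sum_(k < j.+1) pmf k.

Definition poisson_tail j : R := 1 - poisson_cdf j.

Lemma poisson_cdfS j : poisson_cdf j.+1 = poisson_cdf j + pmf j.+1.
Proof. by rewrite /poisson_cdf big_ord_recr. Qed.

Lemma cvg_poisson_cdf : poisson_cdf @ \oo --> (1 : R).
Proof.
have := cvg_series_poisson; rewrite -cvg_shiftS.
have -> // : poisson_cdf = [sequence series pmf n.+1]_n.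
by apply/funext => j; rewrite /= /series/= big_mkord.
Qed.

Lemma poisson_psum_le1 n : \sum_(k < n) pmf k <= 1.
Proof.
have := @poisson_psum_le (fun=> 1) 1 1 n; rewrite lexx => /(_ (fun=> isT) ler01).
rewrite (@poisson_mean_unique (fun=> 1) 1).
  by apply: le_trans; apply: ler_sum => k _; rewrite mulr1.
have := cvg_series_poisson; have -> // : series pmf = series (fun k => pmf k * 1).
by apply/funext => n'; rewrite /series/=; apply: eq_bigr => k _; rewrite mulr1.
Qed.

Lemma poisson_tail_ge0 j : 0 <= poisson_tail j.
Proof. by rewrite subr_ge0 poisson_psum_le1. Qed.

(** [pmf i.+1 / pmf i = lam / i.+1] decreases with [i]. *)
Lemma poisson_log_concave i k : (i <= k)%N -> pmf i * pmf k.+1 <= pmf i.+1 * pmf k.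
Proof.
move=> ik.
have k0 : 0 < k.+1%:R :> R by rewrite ltr0n.
have i0 : 0 < i.+1%:R :> R by rewrite ltr0n.
have -> : pmf k.+1 = lam * pmf k / k.+1%:R by rewrite -poisson_pmfS mulrC mulKf// gt_eqF.
have -> : pmf i.+1 = lam * pmf i / i.+1%:R by rewrite -poisson_pmfS mulrC mulKf// gt_eqF.
rewrite (_ : _ * (_ / _) = lam * pmf i * pmf k / k.+1%:R); last by ring.
rewrite [leRHS]mulrAC; apply: ler_wpM2l.
  by rewrite !mulr_ge0 ?(ltW lam0) ?(ltW (poisson_pmf_gt0 _)).
by rewrite lef_pV2 ?posrE// ler_nat.
Qed.

(** The ratio tail / pmf decreases: log-concavity compares the tails termwise. *)
Lemma poisson_tail_ratio j :
  pmf j * poisson_tail j.+1 <= pmf j.+1 * poisson_tail j.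
Proof.
have lim_l : (fun n => pmf j * (poisson_cdf n.+1 - poisson_cdf j.+1)) @ \oo -->
    pmf j * (1 - poisson_cdf j.+1).
  apply: cvgMl_tmp; apply: cvgB; last exact: cvg_cst.
  by have := cvg_poisson_cdf; rewrite -cvg_shiftS.
have lim_r : (fun n => pmf j.+1 * (poisson_cdf n - poisson_cdf j)) @ \oo -->
    pmf j.+1 * (1 - poisson_cdf j).
  by apply: cvgMl_tmp; apply: cvgB; [exact: cvg_poisson_cdf|exact: cvg_cst].
apply: (ler_cvg_to lim_l lim_r).
exists j => // n /=; elim: n => [|n IH]; first by rewrite leqn0 => /eqP ->; rewrite !subrr !mulr0.
rewrite leq_eqVlt => /predU1P[->|jn]; first by rewrite !subrr !mulr0.
rewrite [poisson_cdf n.+2]poisson_cdfS [poisson_cdf n.+1]poisson_cdfS.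
have := poisson_log_concave (ltnW jn); have := IH jn.
by rewrite [poisson_cdf n.+1]poisson_cdfS; lra.
Qed.

(** Left-hand counterpart of [poisson_tail_ratio]: the ratio cdf / pmf increases,
    with the gain [pmf j * pmf 0] that produces the factor [1 - expR (- lam)]. *)
Lemma poisson_cdf_ratio j :
  pmf j.+1 * poisson_cdf j <= pmf j * (poisson_cdf j.+1 - pmf 0).
Proof.
have -> : poisson_cdf j.+1 - pmf 0 = \sum_(k < j.+1) pmf k.+1.
  by rewrite /poisson_cdf big_ord_recl/= addrC addKr.
rewrite !mulr_sumr; apply: ler_sum => k _.
have kj : (k <= j)%N by rewrite -ltnS.
by have := poisson_log_concave kj; rewrite mulrC [leRHS]mulrC.
Qed.

(** [stein_sol h j], defined from the partial sums below, is the value at [j.+1] of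
    the solution g of the Stein-Chen equation
    [lam g(j+1) - j g(j) = h j - poisson_mean h]; the shift of the index avoids
    the arbitrary value g(0). *)
Definition stein_sum h j : R := \sum_(k < j.+1) pmf k * (h k - poisson_mean h).

Definition stein_sol h j : R := stein_sum h j / (lam * pmf j).

Definition stein_diff h j : R := stein_sol h j.+1 - stein_sol h j.

Lemma stein_sumS h j :
  stein_sum h j.+1 = stein_sum h j + pmf j.+1 * (h j.+1 - poisson_mean h).
Proof. by rewrite /stein_sum big_ord_recr. Qed.

Lemma stein_sumE h j : stein_sum h j =
  \sum_(k < j.+1) pmf k * h k - poisson_mean h * poisson_cdf j.
Proof.
rewrite /stein_sum /poisson_cdf mulr_sumr -sumrB; apply: eq_bigr => k _; ring.
Qed.

Lemma stein_eq0 h : lam * stein_sol h 0 = h 0%N - poisson_mean h.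
Proof.
have p0 := poisson_pmf_gt0 0.
by rewrite /stein_sol /stein_sum big_ord1; field; rewrite !gt_eqF.
Qed.

Lemma stein_eqS h j :
  lam * stein_sol h j.+1 - j.+1%:R * stein_sol h j = h j.+1 - poisson_mean h.
Proof.
have p0 := poisson_pmf_gt0 j; have p1 := poisson_pmf_gt0 j.+1.
have j0 : j.+1%:R != 0 :> R by rewrite pnatr_eq0.
rewrite /stein_sol stein_sumS -(poisson_pmfS j).
by field; rewrite nat1r j0 !gt_eqF.
Qed.

Lemma stein_diff_affine h a b (s t : R) j : (forall k, a <= h k <= b) ->
  stein_diff (fun k => t + s * h k) j = s * stein_diff h j.
Proof.
move=> hab.
have E i : stein_sol (fun k => t + s * h k) i = s * stein_sol h i.
  rewrite /stein_sol mulrA /stein_sum (poisson_mean_affine _ _ hab) mulr_sumr.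
  by congr (_ / _); apply: eq_bigr => k _; ring.
by rewrite /stein_diff !E mulrBr.
Qed.

(** As a linear form in [h], [stein_diff h j] has nonpositive coefficients at all
    points but [j.+1], because tail / pmf decreases and cdf / pmf increases. So it
    is at most [c] times the coefficient at [j.+1], which is the sum of a tail and
    of [pmf j.+1 * cdf j / pmf j], up to the factor [lam]. *)
Lemma stein_diff_ub h c j : (forall k, 0 <= h k <= c) ->
  lam * stein_diff h j <= c * (1 - expR (- lam)).
Proof.
move=> h0c.
have p0 := poisson_pmf_gt0 j; have p1 := poisson_pmf_gt0 j.+1.
have tl := poisson_tail_ge0 j.+1.
have := poisson_tail_ratio j; have := poisson_cdf_ratio j; rewrite -poisson_pmf0.
have c0 : 0 <= c by case/andP: (h0c 0%N) => /le_trans; apply.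
have := poisson_psum_le j.+2 h0c (lexx 0).
rewrite /stein_diff /stein_sol !stein_sumE big_ord_recr/=.
have : 0 <= \sum_(k < j.+1) pmf k * h k.
  rewrite sumr_ge0// => k _; rewrite mulr_ge0 ?(ltW (poisson_pmf_gt0 _))//.
  by case/andP: (h0c k).
have /andP[] := h0c j.+1.
have u0 : 0 <= poisson_cdf j.
  by rewrite sumr_ge0// => k _; rewrite (ltW (poisson_pmf_gt0 _)).
have pz0 := poisson_pmf_gt0 0.
move: tl; rewrite /poisson_tail poisson_cdfS.
move: p0 p1 u0 pz0; move: (pmf j) (pmf j.+1) (poisson_cdf j) (pmf 0).
move: (\sum_(k < j.+1) _) (h j.+1) (poisson_mean h) => H x nu p' p u z p'0 p0 u0 z0.
move=> W0 x0 xc H0 Hnu B A.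
(* H, nu - (H + p * x) and x carry the values of h on the left of j.+1, on its
   right and at j.+1 *)
have -> : lam * ((H + p * x - nu * (u + p)) / (lam * p) - (H - nu * u) / (lam * p')) =
   x * ((1 - (u + p)) + p * u / p')
   - H * (p * (1 - u) - p' * (1 - (u + p))) / (p * p')
   - (nu - (H + p * x)) * (p' * (u + p) - p * u) / (p * p').
  by field; rewrite !gt_eqF.
have h1 : 0 <= H * (p * (1 - u) - p' * (1 - (u + p))) / (p * p').
  by rewrite divr_ge0 ?mulr_ge0 ?subr_ge0// ltW.
have h2 : 0 <= (nu - (H + p * x)) * (p' * (u + p) - p * u) / (p * p').
  rewrite divr_ge0 ?mulr_ge0 ?subr_ge0// ?(ltW p0) ?(ltW p'0)//.
  by apply: (le_trans B); rewrite ler_wpM2l ?(ltW p'0)// gerBl ltW.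
have h3 : p * u / p' <= u + p - z.
  by rewrite ler_pdivrMr// [leRHS]mulrC.
have h4 : 0 <= p * u / p' by rewrite divr_ge0 ?mulr_ge0 // ltW.
have h5 : x * ((1 - (u + p)) + p * u / p') <= c * (1 - z).
  by apply: ler_pM => //; lra.
lra.
Qed.

(** [stein_diff] kills constants and is odd, so [stein_diff_ub] applies to
    [h - a] and to [a + c - h]. *)
Lemma stein_diff_le h a c j : (forall k, a <= h k <= a + c) ->
  lam * `|stein_diff h j| <= c * (1 - expR (- lam)).
Proof.
move=> hac.
have e1 := stein_diff_affine 1 (- a) j hac.
have e2 := stein_diff_affine (-1) (a + c) j hac.
have b1 : lam * (1 * stein_diff h j) <= c * (1 - expR (- lam)).
  by rewrite -e1; apply: stein_diff_ub => k; have /andP[] := hac k; lra.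
have b2 : lam * (-1 * stein_diff h j) <= c * (1 - expR (- lam)).
  by rewrite -e2; apply: stein_diff_ub => k; have /andP[] := hac k; lra.
rewrite -[X in X * _]gtr0_norm// -normrM ler_norml; apply/andP; split; lra.
Qed.
End PoissonSteinEquation.

(** * The Poisson mean of the Stein differences *)

Section SecondOrder.
Context {R : realType} (lam : R).
Context (lam0 : 0 < lam).
Implicit Types (h : nat -> R) (k j n m b : nat).

Local Notation pmf := (poisson_pmf lam).
Local Notation Q := (charlier2 lam).

Lemma charlier2E k : Q k = (k%:R - lam) ^+ 2 - k%:R.
Proof. by rewrite /charlier2; ring. Qed.

Lemma charlier2S k : Q k.+1 = Q k + 2 * (k%:R - lam).
Proof. by rewrite /charlier2 -natr1; ring. Qed.

Lemma sum_poisson_charlier2 j :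
  \sum_(k < j.+1) pmf k * Q k = lam * (pmf j * (lam - j%:R)).
Proof.
elim: j => [|j IH]; first by rewrite big_ord1 /charlier2 /=; ring.
rewrite big_ord_recr/= IH.
have -> : lam * (pmf j * (lam - j%:R)) = j.+1%:R * pmf j.+1 * (lam - j%:R).
  by rewrite poisson_pmfS//; ring.
by rewrite /charlier2 -natr1; ring.
Qed.

(** The polynomial is convex, positive at 0 and negative at the first integer
    above [lam], so its signs on the integers follow the pattern + - +. *)
Lemma charlier2_signs : exists m b, [/\ (m < b)%N,
  (forall k, (k <= m)%N -> 0 <= Q k),
  (forall k, (m < k <= b)%N -> Q k < 0) &
  (forall k, (b < k)%N -> 0 <= Q k)].
Proof.
have exQ : exists k, Q k < 0.
  exists (Num.truncn lam).+1.
  have /andP[] := truncn_itv (ltW lam0).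
  rewrite charlier2E; case: (Num.truncn lam) => [|t] tl lt.
    by have : 0 < lam * (1 - lam); [rewrite mulr_gt0// subr_gt0|lra].
  have T1 : 1 <= t.+1%:R :> R by rewrite ler1n.
  move: tl lt; rewrite -[t.+2%:R]natr1; move: (t.+1%:R : R) T1 => T T1 tl lt.
  have : 0 <= (lam - T) * (T + 1 - lam) by rewrite mulr_ge0 ?subr_ge0// ltW.
  by lra.
case: (ex_minnP exQ) => -[|m].
  by rewrite charlier2E sub0r sqrrN subr0; have := exprn_gt0 2 lam0; lra.
move=> Qm1 Qmin.
have exQ' : exists k, (m < k)%N && (0 <= Q k).
  have z0 : 0 <= 2 * lam + 1 by rewrite addr_ge0// mulr_ge0// ltW.
  pose t := Num.bound (2 * lam + 1).
  exists (maxn m.+1 t); rewrite leq_maxl/= /charlier2.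
  have : t%:R <= (maxn m.+1 t)%:R :> R by rewrite ler_nat leq_maxr.
  have := archi_boundP z0; rewrite -/t.
  move: ((maxn m.+1 t)%:R : R) => T tb tT.
  have : 0 <= T * (T - (2 * lam + 1)) by rewrite mulr_ge0//; lra.
  by have := sqr_ge0 lam; lra.
case: (ex_minnP exQ') => -[|b] /andP[//]; rewrite ltnS leq_eqVlt => /predU1P[<-|mb].
  by move=> Qb; move: Qm1; rewrite ltNge Qb.
move=> Qb1 bmin.
have Qneg k : (m < k <= b)%N -> Q k < 0.
  move=> /andP[mk kb]; rewrite ltNge; apply/negP => Qk.
  by have := bmin k; rewrite mk Qk => /(_ isT); rewrite ltnNge kb.
exists m, b; split => //.
  move=> k km; rewrite leNgt; apply/negP => Qk.
  by have := Qmin k Qk; rewrite ltnNge km.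
have bl : lam < b%:R.
  have := Qneg b; rewrite mb leqnn => /(_ isT); move: Qb1; rewrite charlier2S; lra.
elim=> // k IH; rewrite ltnS leq_eqVlt => /predU1P[<-//|bk].
rewrite charlier2S; have := IH bk.
have : b%:R <= k%:R :> R by rewrite ler_nat ltnW.
by lra.
Qed.

(** The left side is largest when [h] is the indicator of the integers where [Q] is
    negative. These form an interval [m < k <= b], over which the sum telescopes
    to [lam] times the left side of [poisson_extremal_le]. *)
Lemma sum_charlier2_le h n : (forall k, 0 <= h k <= 1) ->
  - \sum_(k < n) pmf k * Q k * h k <= lam * (3 / 2 * expR (- 1)).
Proof.
move=> h01.
have [m [b [mb Qm Qb Qb']]] := charlier2_signs.
have pos k : 0 <= Q k -> 0 <= pmf k * Q k * h k.
  move=> Qk; rewrite !mulr_ge0// ?(ltW (poisson_pmf_gt0 lam0 _))//.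
  by have /andP[] := h01 k.
pose S j := \sum_(k < j.+1) pmf k * Q k.
have SS j : S j.+1 = S j + pmf j.+1 * Q j.+1 by rewrite /S big_ord_recr.
suff : - \sum_(k < n) pmf k * Q k * h k <= S m - S b.
  move=> /le_trans; apply; rewrite /S !sum_poisson_charlier2 -mulrBr ler_wpM2l ?(ltW lam0)//.
  have := poisson_extremal_le lam0 Qm Qb mb; lra.
have decr k : (m < k <= b)%N -> pmf k * Q k <= 0.
  by move=> /Qb Qk; rewrite mulr_ge0_le0 ?(ltW (poisson_pmf_gt0 lam0 _))// ltW.
have Sb d : (d <= b - m)%N -> S b <= S (b - d)%N.
  elim: d => [|d IH] db; first by rewrite subn0.
  apply: (le_trans (IH (ltnW db))).
  have -> : (b - d = (b - d.+1).+1)%N by lia.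
  by rewrite SS gerDl decr//; lia.
have A1 k : (k <= m.+1)%N -> - \sum_(i < k) pmf i * Q i * h i <= 0.
  move=> km; rewrite oppr_le0 sumr_ge0// => i _; apply/pos/Qm.
  by have := ltn_ord i; lia.
have A2 k : (m + k <= b)%N ->
    - \sum_(i < (m + k).+1) pmf i * Q i * h i <= S m - S (m + k)%N.
  elim: k => [|k IH] mkb; first by rewrite addn0 subrr A1.
  rewrite addnS in mkb *; rewrite SS big_ord_recr/=.
  have := IH (ltnW mkb).
  have : pmf (m + k).+1 * Q (m + k).+1 <= pmf (m + k).+1 * Q (m + k).+1 * h (m + k).+1.
    have := decr (m + k).+1; rewrite mkb ltnS leq_addr => /(_ isT) x0.
    by have /andP[_ h1] := h01 (m + k).+1; rewrite -[leLHS]mulr1 ler_wnM2l.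
  by lra.
have A3 k : - \sum_(i < (b + k).+1) pmf i * Q i * h i <= S m - S b.
  elim: k => [|k IH].
    by have := A2 (b - m)%N; rewrite addn0 subnKC ?(ltnW mb)//; apply.
  rewrite addnS big_ord_recr/=; have := pos (b + k).+1 (Qb' _ _).
  by move=> /(_ (leq_addr _ _)); lra.
have [nm|mn] := leqP n m.+1.
  by apply: (le_trans (A1 _ nm)); rewrite subr_ge0 -(subKn (ltnW mb)) Sb.
have [nb|bn] := leqP n b.+1; last by have := A3 (n - b.+1)%N; rewrite -addSn subnKC// ltnW.
have := A2 (n - m.+1)%N; rewrite -addSn subnKC ?(ltnW mn)//.
have nE : (m + (n - m.+1) = b - (b.+1 - n))%N by lia.
rewrite nE => /(_ (leq_subr _ _)) /le_trans; apply.
by rewrite lerD2l lerN2 Sb//; lia.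
Qed.

Lemma stein_diff_bounded h k : (forall k, 0 <= h k <= 1) ->
  - ((1 - expR (- lam)) / lam) <= stein_diff lam h k <= (1 - expR (- lam)) / lam.
Proof.
move=> h01; rewrite -ler_norml ler_pdivlMr// mulrC.
have := @stein_diff_le _ _ lam0 h 0 1 k; rewrite mul1r; apply => i.
by rewrite add0r h01.
Qed.

(** Summation by parts. The weight [Q] appears because its increment
    [2 * (n%:R - lam)] is what the recurrence of [pmf] leaves of
    [pmf n * stein_diff h n]. *)
Lemma sum_stein_diff h n :
  lam * (\sum_(k < n) pmf k * stein_diff lam h k) =
  (2 * lam)^-1 * (- \sum_(k < n.+1) pmf k * Q k * (h k - poisson_mean lam h)
    + (2 * n%:R + Q n) * stein_sum lam h n).
Proof.
have l0 : lam != 0 by rewrite gt_eqF.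
elim: n => [|n IH].
  by rewrite big_ord0 big_ord1 /stein_sum big_ord1; ring.
rewrite big_ord_recr/= mulrDr IH [in RHS]big_ord_recr/= /stein_diff /stein_sol.
have p0 := poisson_pmf_gt0 lam0 n; have p1 := poisson_pmf_gt0 lam0 n.+1.
have -> : lam * (pmf n * (stein_sum lam h n.+1 / (lam * pmf n.+1) -
    stein_sum lam h n / (lam * pmf n))) =
    n.+1%:R / lam * stein_sum lam h n.+1 - stein_sum lam h n.
  rewrite mulrBr mulrBr.
  have -> : lam * (pmf n * (stein_sum lam h n / (lam * pmf n))) = stein_sum lam h n.
    by field; rewrite l0 gt_eqF.
  rewrite mulrA -(poisson_pmfS lam0 n); congr (_ - _).
  by field; rewrite l0 gt_eqF.
rewrite stein_sumS charlier2S -[n.+1%:R]natr1.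
by field.
Qed.

(** The tail decreases fast enough to absorb the quadratic weight that
    [sum_stein_diff] leaves at the boundary. *)
Lemma poisson_tailS j : j.+1%:R * poisson_tail lam j.+1 <= lam * poisson_tail lam j.
Proof.
rewrite -(ler_pM2l (poisson_pmf_gt0 lam0 j)).
have := ler_wpM2l (ler0n R j.+1) (poisson_tail_ratio lam0 j).
by rewrite [leRHS]mulrA poisson_pmfS//; lra.
Qed.

Lemma poisson_mean01 h : (forall k, 0 <= h k <= 1) -> 0 <= poisson_mean lam h <= 1.
Proof.
move=> h01; have := poisson_psum_le lam0 0 h01 (lexx 0).
rewrite big_ord0 => -> /=; apply: (poisson_mean_le lam0 h01) => n.
apply: le_trans (poisson_psum_le1 lam0 n); apply: ler_sum => k _.
by rewrite ler_piMr ?(ltW (poisson_pmf_gt0 lam0 _))//; case/andP: (h01 k).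
Qed.

Lemma stein_sum_le_tail h j : (forall k, 0 <= h k <= 1) ->
  stein_sum lam h j <= poisson_tail lam j.
Proof.
move=> h01; have /andP[nu0 nu1] := poisson_mean01 h01.
have := poisson_psum_le lam0 j.+1 h01 (lexx 0).
have := poisson_tail_ge0 lam0 j; rewrite stein_sumE /poisson_tail; nra.
Qed.

Lemma cvg_poisson_tail : poisson_tail lam @ \oo --> (0 : R).
Proof.
rewrite -[X in _ --> X](subrr 1); apply: cvgB; first exact: cvg_cst.
exact: cvg_poisson_cdf.
Qed.

(** By [sum_stein_diff], the partial sums are bounded with
    [sum_charlier2_le] up to boundary terms that a multiple of the Poisson tail
    dominates. *)
Lemma poisson_mean_stein_diff_le h : (forall k, 0 <= h k <= 1) ->
  lam * poisson_mean lam (stein_diff lam h) <= 3 / 4 * expR (- 1).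
Proof.
move=> h01; have /andP[nu0 nu1] := poisson_mean01 h01.
have l0 : 0 < (2 * lam)^-1 by rewrite invr_gt0 mulr_gt0.
have bound n : lam * (\sum_(k < n.+2) pmf k * stein_diff lam h k) <=
    3 / 4 * expR (- 1) + 5 / 2 * lam * poisson_tail lam n.
  rewrite sum_stein_diff mulrC ler_pdivrMr ?mulr_gt0//.
  have -> : \sum_(k < n.+3) pmf k * Q k * (h k - poisson_mean lam h) =
      \sum_(k < n.+3) pmf k * Q k * h k
      - poisson_mean lam h * (lam * (pmf n.+2 * (lam - n.+2%:R))).
    rewrite -sum_poisson_charlier2 mulr_sumr -sumrB; apply: eq_bigr => k _; ring.
  have h1 := sum_charlier2_le n.+3 h01.
  have p2 := poisson_pmf_gt0 lam0 n.+2; have p1 := poisson_pmf_gt0 lam0 n.+1.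
  have t0 := poisson_tail_ge0 lam0 n; have t2 := poisson_tail_ge0 lam0 n.+2.
  have t1 := poisson_tail_ge0 lam0 n.+1.
  have h2 : poisson_mean lam h * (lam * (pmf n.+2 * (lam - n.+2%:R))) <=
      lam * (lam * poisson_tail lam n).
    have pt : pmf n.+2 <= poisson_tail lam n.
      by move: t2; rewrite /poisson_tail !poisson_cdfS; lra.
    have X : pmf n.+2 * (lam - n.+2%:R) <= lam * poisson_tail lam n.
      apply: (@le_trans _ _ (pmf n.+2 * lam)).
        by rewrite ler_wpM2l ?(ltW p2)// gerBl.
      by rewrite mulrC ler_wpM2l ?(ltW lam0).
    apply: (le_trans (ler_wpM2l nu0 (ler_wpM2l (ltW lam0) X))).
    by rewrite ler_piMl// !mulr_ge0 ?(ltW lam0).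
  have h3 : (2 * n.+2%:R + Q n.+2) * stein_sum lam h n.+2 <=
      4 * (lam * (lam * poisson_tail lam n)).
    have QE : 2 * n.+2%:R + Q n.+2 = (n.+2%:R - lam) ^+ 2 + n.+2%:R.
      by rewrite charlier2E; ring.
    have Q0 : 0 <= 2 * n.+2%:R + Q n.+2 by rewrite QE addr_ge0// sqr_ge0.
    apply: (le_trans (ler_wpM2l Q0 (stein_sum_le_tail n.+2 h01))).
    have T1 := ler_wpM2l (ltW lam0) (poisson_tailS n).
    have T2 := ler_wpM2l (ler0n R n.+1) (poisson_tailS n.+1).
    have T3 : poisson_tail lam n.+2 <= poisson_tail lam n.
      by rewrite /poisson_tail !poisson_cdfS; lra.
    have QN : 2 * n.+2%:R + Q n.+2 <= 3 * (n.+1%:R * n.+2%:R) + lam ^+ 2.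
      rewrite QE -[n.+2%:R]natr1; have : 1 <= n.+1%:R :> R by rewrite ler1n.
      by move: (n.+1%:R : R) => N N1; have := mulr_ge0 (ltW lam0) (le_trans ler01 N1); nra.
    apply: (le_trans (ler_wpM2r t2 QN)).
    have := ler_wpM2l (sqr_ge0 lam) T3.
    by lra.
  by lra.
have D01 k := stein_diff_bounded k h01.
have Dc := cvg_poisson_mean lam0 D01.
have lhs : (fun n => lam * series (fun k => pmf k * stein_diff lam h k) n.+2) @ \oo -->
    lam * poisson_mean lam (stein_diff lam h).
  by apply: cvgMl_tmp; move: Dc; rewrite -cvg_shiftS -cvg_shiftS.
have rhs : (fun n => 3 / 4 * expR (- 1) + 5 / 2 * lam * poisson_tail lam n) @ \oo -->
    3 / 4 * expR (- 1) + 5 / 2 * lam * 0.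
  by apply: cvgD; [exact: cvg_cst|apply: cvgMl_tmp; exact: cvg_poisson_tail].
have := ler_cvg_to lhs rhs; rewrite mulr0 addr0; apply.
by near=> n; rewrite /series/= big_mkord; exact: bound.
Unshelve. all: by end_near. Qed.

(** The lower bound is the upper bound for [1 - h]. *)
Lemma poisson_mean_stein_diff_norm_le h : (forall k, 0 <= h k <= 1) ->
  lam * `|poisson_mean lam (stein_diff lam h)| <= 3 / 4 * expR (- 1).
Proof.
move=> h01; have D01 k := stein_diff_bounded k h01.
have b1 := poisson_mean_stein_diff_le h01.
have h01' k : 0 <= 1 + (-1) * h k <= 1 by have /andP[] := h01 k; lra.
have := poisson_mean_stein_diff_le h01'.
have -> : stein_diff lam (fun k => 1 + (-1) * h k) = fun k => 0 + (-1) * stein_diff lam h k.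
  by apply/funext => k; rewrite (stein_diff_affine lam0 _ _ _ h01) add0r.
rewrite (poisson_mean_affine lam0 _ _ D01) => b2.
rewrite -[X in X * _](gtr0_norm lam0) -normrM ler_norml; apply/andP; split; lra.
Qed.
End SecondOrder.

(** * The binomial law *)

Section UnimodalSums.
Context {R : realType}.

Lemma unimodal_le_mode (b : nat -> R) (m : nat) :
  (forall k, (k < m)%N -> b k <= b k.+1) ->
  (forall k, (m <= k)%N -> b k.+1 <= b k) -> forall k, b k <= b m.
Proof.
move=> bi bd k; have [km|mk] := leqP k m; last first.
  rewrite -(subnKC (ltnW mk)); elim: (k - m)%N => [|i IH]; first by rewrite addn0.
  by rewrite addnS; apply: le_trans (bd _ (leq_addr _ _)) IH.
rewrite -(subnKC km); have : (k + (m - k) <= m)%N by rewrite subnKC.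
elim: (m - k)%N => [|i IH]; first by rewrite addn0.
by rewrite addnS => kim; apply: le_trans (IH (ltnW kim)) (bi _ kim).
Qed.

(** Summation by parts moves the difference onto [b], whose total variation is at
    most [2 * b m]; [X] below is the sum without its boundary term. *)
Lemma unimodal_sum_le (b f : nat -> R) (m n : nat) (M : R) :
  (forall k, 0 <= b k) ->
  (forall k, (k < m)%N -> b k <= b k.+1) ->
  (forall k, (m <= k)%N -> b k.+1 <= b k) ->
  (forall k, `|f k| <= M) ->
  `|\sum_(k < n) b k * (f k.+1 - f k)| <= 2 * M * b m.
Proof.
move=> b0 bi bd fM.
have M0 : 0 <= M by apply: le_trans (fM 0%N).
case: n => [|n]; first by rewrite big_ord0 normr0 !mulr_ge0.
pose X k := \sum_(i < k.+1) b i * (f i.+1 - f i) - b k * f k.+1.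
have XS k : X k.+1 = X k - (b k.+1 - b k) * f k.+1.
  by rewrite /X [in LHS]big_ord_recr/=; ring.
have XSle k : `|X k.+1| <= `|X k| + `|b k.+1 - b k| * M.
  rewrite XS (le_trans (ler_normB _ _))// lerD2l normrM ler_wpM2l//.
have Xl k : (k <= m)%N -> `|X k| <= M * b k.
  elim: k => [_|k IH km].
    rewrite /X big_ord1 mulrBr addrAC subrr add0r normrN normrM ger0_norm// mulrC.
    by rewrite ler_wpM2r.
  have := XSle k; rewrite [`|b _ - _|]ger0_norm ?subr_ge0 ?bi//.
  by have := IH (ltnW km); lra.
have Xr k : (m <= k)%N -> `|X k| <= M * (2 * b m - b k).
  move=> /subnKC <-; elim: (k - m)%N => {k} [|k IH].
    by rewrite addn0; have := Xl m (leqnn _); lra.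
  have := bd (m + k)%N (leq_addr _ _); rewrite addnS => bk.
  have := XSle (m + k)%N; rewrite [`|b _ - _|]ler0_norm ?subr_le0//; lra.
have bm := unimodal_le_mode bi bd.
have -> : \sum_(k < n.+1) b k * (f k.+1 - f k) = X n + b n * f n.+1.
  by rewrite /X subrK.
apply: le_trans (ler_normD _ _) _.
rewrite normrM (ger0_norm (b0 n)).
have fn : b n * `|f n.+1| <= b n * M by rewrite ler_wpM2l.
have Mb : b n * M <= b m * M by rewrite ler_wpM2r.
by case: (leqP n m) => [/Xl|/ltnW/Xr]; lra.
Qed.

End UnimodalSums.

Section BinomialMean.
Context {R : realType} (p : R).
Context (p0 : 0 < p) (p1 : p < 1).
Implicit Types (f g h : nat -> R) (n k : nat).

Definition binomial_mean n f : R := \sum_(k < n.+1) binomial_pmf n p k * f k.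

Let pmf_ge0 n k : 0 <= binomial_pmf n p k.
Proof. by rewrite binomial_pmf_ge0// !ltW. Qed.

Lemma binomial_pmfE n k :
  binomial_pmf n p k = p ^+ k * (1 - p) ^+ (n - k) * 'C(n, k)%:R.
Proof. by rewrite mulr_natr. Qed.

Lemma binomial_pmfS n k :
  binomial_pmf n.+1 p k.+1 = (1 - p) * binomial_pmf n p k.+1 + p * binomial_pmf n p k.
Proof.
rewrite !binomial_pmfE binS natrD subSS exprS.
have [nk|kn] := leqP n k; first by rewrite bin_small//; ring.
by rewrite -[(n - k)%N](subnSK kn) exprS; ring.
Qed.

Lemma binomial_meanS n f : binomial_mean n.+1 f =
  (1 - p) * binomial_mean n f + p * binomial_mean n (fun k => f k.+1).
Proof.
rewrite /binomial_mean big_ord_recl/=.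
under eq_bigr do rewrite binomial_pmfS mulrDl.
rewrite big_split/= addrA; congr (_ + _); last first.
  by rewrite mulr_sumr; apply: eq_bigr => k _; rewrite mulrA.
rewrite [in RHS]big_ord_recl mulrDr; congr (_ + _).
  by rewrite !binomial_pmfE !bin0 !subn0 exprS; ring.
rewrite big_ord_recr/= [X in _ + _ * X * _]binomial_pmfE bin_small// !mulr0 mul0r addr0.
by rewrite mulr_sumr; apply: eq_bigr => k _; rewrite mulrA.
Qed.

Lemma binomial_mean_diff n f : binomial_mean n.+1 f - binomial_mean n f =
  p * binomial_mean n (fun k => f k.+1 - f k).
Proof.
rewrite binomial_meanS [X in _ = p * X](_ : _ =
  binomial_mean n (fun k => f k.+1) - binomial_mean n f); first by ring.
by rewrite /binomial_mean -sumrB; apply: eq_bigr => k _; rewrite mulrBr.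
Qed.

Lemma binomial_mean1 n : binomial_mean n (fun=> 1) = 1.
Proof.
elim: n => [|n IH].
  by rewrite /binomial_mean big_ord1 binomial_pmfE expr0 subnn expr0 bin0 !mulr1.
by rewrite binomial_meanS IH; ring.
Qed.

Lemma binomial_mean_norm_le n f (M : R) : (forall k, `|f k| <= M) ->
  `|binomial_mean n f| <= M.
Proof.
move=> fM; rewrite -[leRHS]mul1r -(binomial_mean1 n) mulr_suml.
apply: (le_trans (ler_norm_sum _ _ _)); apply: ler_sum => k _.
by rewrite mulr1 normrM ger0_norm// ler_wpM2l.
Qed.

Lemma binomial_pmf_diag n k :
  k.+1%:R * binomial_pmf n.+1 p k.+1 = n.+1%:R * p * binomial_pmf n p k.
Proof.
have : k.+1%:R * 'C(n.+1, k.+1)%:R = n.+1%:R * 'C(n, k)%:R :> R.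
  by rewrite -!natrM -mul_bin_diag.
rewrite !binomial_pmfE subSS exprS => E.
transitivity (p * p ^+ k * (1 - p) ^+ (n - k) * (k.+1%:R * 'C(n.+1, k.+1)%:R)).
  by ring.
by rewrite E; ring.
Qed.

Lemma binomial_pmf_left n k :
  k.+1%:R * (1 - p) * binomial_pmf n p k.+1 = (n - k)%:R * p * binomial_pmf n p k.
Proof.
have : k.+1%:R * 'C(n, k.+1)%:R = (n - k)%:R * 'C(n, k)%:R :> R.
  by rewrite -!natrM mul_bin_left.
rewrite !binomial_pmfE => E.
have [nk|kn] := leqP n k.
  have /eqP nk0 : (n - k == 0)%N by rewrite subn_eq0.
  by rewrite bin_small// nk0 !mulr0 !mul0r.
transitivity (p * p ^+ k * (1 - p) ^+ (n - k) * (k.+1%:R * 'C(n, k.+1)%:R)).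
  by rewrite -[(n - k)%N](subnSK kn) !exprS; ring.
by rewrite E; ring.
Qed.

(** By [binomial_pmf_left], the sign of the increment at [k] is that of
    [(n - k) p - k.+1 (1 - p)], which decreases with [k]. *)
Lemma binomial_unimodal n : exists m,
  (forall k, (k < m)%N -> binomial_pmf n p k <= binomial_pmf n p k.+1) /\
  (forall k, (m <= k)%N -> binomial_pmf n p k.+1 <= binomial_pmf n p k).
Proof.
have q0 : 0 < 1 - p by rewrite subr_gt0.
have ex : exists k, (n - k)%:R * p <= k.+1%:R * (1 - p).
  by exists n; rewrite subnn mul0r mulr_ge0// ltW.
case: (ex_minnP ex) => m mm mmin; exists m; split => k km.
  have kq : 0 < k.+1%:R * (1 - p) by rewrite mulr_gt0.
  rewrite -(ler_pM2l kq) binomial_pmf_left ler_wpM2r// ltW// ltNge.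
  by apply/negP => /mmin; rewrite leqNgt km.
have kq : 0 < k.+1%:R * (1 - p) by rewrite mulr_gt0.
rewrite -(ler_pM2l kq) binomial_pmf_left ler_wpM2r//.
apply: le_trans (le_trans mm _).
  by rewrite ler_wpM2r ?(ltW p0)// ler_nat leq_sub2l.
by rewrite ler_wpM2r ?(ltW q0)// ler_nat.
Qed.

Lemma binomial_mean_shift_le n f (M B : R) : (forall k, `|f k| <= M) ->
  (forall k, binomial_pmf n p k <= B) ->
  `|binomial_mean n (fun k => f k.+1 - f k)| <= 2 * M * B.
Proof.
move=> fM bB; have [m [bi bd]] := binomial_unimodal n.
apply: le_trans (unimodal_sum_le n.+1 (pmf_ge0 n) bi bd fM) _.
by rewrite ler_wpM2l ?bB// mulr_ge0// (le_trans _ (fM 0%N)).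
Qed.

(** Size biasing: [E (S g(S - 1)) = (n + 1) p E g(S')] for S of law Bin(n + 1, p) and
    S' of law Bin(n, p). *)
Lemma binomial_mean_size_bias n g :
  \sum_(k < n.+2) binomial_pmf n.+1 p k * (k%:R * g k.-1) =
  n.+1%:R * p * binomial_mean n g.
Proof.
rewrite big_ord_recl/= mul0r mulr0 add0r /binomial_mean mulr_sumr.
apply: eq_bigr => k _; rewrite /bump/= add1n.
by rewrite mulrA [_ * k.+1%:R]mulrC binomial_pmf_diag mulrA.
Qed.

(** The Stein equation makes the left side a mean of
    [lam g(S + 1) - S g(S)]; size biasing turns the second part into a mean under
    one trial less, and [binomial_mean_diff] compares the two means. *)
Lemma binomial_poisson_stein n h :
  binomial_mean n.+1 h - poisson_mean (n.+1%:R * p) h =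
  n.+1%:R * p * p * binomial_mean n (stein_diff (n.+1%:R * p) h).
Proof.
set lam := n.+1%:R * p; have lam0 : 0 < lam by rewrite mulr_gt0.
have steinE k : h k - poisson_mean lam h =
    lam * stein_sol lam h k - k%:R * stein_sol lam h k.-1.
  by case: k => [|k]; rewrite ?mul0r ?subr0 ?stein_eq0// stein_eqS.
have -> : binomial_mean n.+1 h - poisson_mean lam h =
    binomial_mean n.+1 (fun k => h k - poisson_mean lam h).
  rewrite -[X in _ - X]mul1r -(binomial_mean1 n.+1) /binomial_mean mulr_suml -sumrB.
  by apply: eq_bigr => k _; ring.
have -> : binomial_mean n.+1 (fun k => h k - poisson_mean lam h) =
   lam * (binomial_mean n.+1 (stein_sol lam h) - binomial_mean n (stein_sol lam h)).
  rewrite mulrBr -binomial_mean_size_bias /binomial_mean mulr_sumr -sumrB.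
  by apply: eq_bigr => k _; rewrite steinE; ring.
by rewrite binomial_mean_diff mulrA.
Qed.

Lemma binomial_poisson_le n h (a c : R) : (forall k, a <= h k <= a + c) ->
  `|binomial_mean n.+1 h - poisson_mean (n.+1%:R * p) h| <=
    c * (1 - expR (- (n.+1%:R * p))) * p.
Proof.
set lam := n.+1%:R * p => hac; have lam0 : 0 < lam by rewrite mulr_gt0.
rewrite binomial_poisson_stein -/lam mulrAC normrM (gtr0_norm p0) ler_wpM2r ?(ltW p0)//.
rewrite normrM (gtr0_norm lam0) mulrC -ler_pdivlMr//.
apply: binomial_mean_norm_le => k.
rewrite ler_pdivlMr// mulrC; exact: (stein_diff_le lam0 k hac).
Qed.

(** [binomial_poisson_le] for the indicator of [k]. *)
Lemma binomial_pmf_le_poisson n k : binomial_pmf n.+1 p k <=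
  poisson_pmf (n.+1%:R * p) k + (1 - expR (- (n.+1%:R * p))) * p.
Proof.
set lam := n.+1%:R * p; have lam0 : 0 < lam by rewrite mulr_gt0.
pose h i : R := (i == k)%:R.
have h01 i : 0 <= h i <= 0 + 1 by rewrite /h add0r; case: eqP; rewrite ?lexx ?ler01.
have := binomial_poisson_le n h01; rewrite -/lam mul1r => /ler_normlP[_].
have -> : poisson_mean lam h = poisson_pmf lam k.
  apply: poisson_mean_unique; apply: cvg_near_cst.
  exists k.+1 => // i /= ki; rewrite /series/= big_mkord.
  rewrite (bigD1 (Ordinal ki))//= /h eqxx mulr1 big1 ?addr0// => j.
  by rewrite -val_eqE/= => /negPf ->; rewrite mulr0.
suff : binomial_pmf n.+1 p k <= binomial_mean n.+1 h by lra.
have [kn|nk] := ltnP k n.+2.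
  rewrite /binomial_mean (bigD1 (Ordinal kn))//= /h eqxx mulr1 lerDl.
  by rewrite sumr_ge0// => i _; rewrite mulr_ge0.
rewrite binomial_pmfE bin_small// mulr0 sumr_ge0// => i _.
by rewrite mulr_ge0// /h.
Qed.

(** The mean of [D := stein_diff h] under n trials is split into its Poisson mean,
    the error of the Poisson approximation for [D], and the effect of the
    last trial. *)
Lemma binomial_poisson_second_order n h (B : R) :
  (forall k, 0 <= h k <= 1) -> (forall k, binomial_pmf n p k <= B) ->
  `|binomial_mean n.+1 h - poisson_mean (n.+1%:R * p) h| <=
    3 / 4 * expR (- 1) * p + 2 * (1 - expR (- (n.+1%:R * p))) ^+ 2 * p ^+ 2
    + 2 * (1 - expR (- (n.+1%:R * p))) * p ^+ 2 * B.
Proof.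
set lam := n.+1%:R * p => h01 bB; have lam0 : 0 < lam by rewrite mulr_gt0.
rewrite binomial_poisson_stein -/lam.
set D := stein_diff lam h; set E := 1 - expR (- lam); pose M := E / lam.
have DM k : - M <= D k <= - M + 2 * M.
  by rewrite (_ : - M + 2 * M = M); [exact: stein_diff_bounded|ring].
have ME : lam * M = E by rewrite /M mulrC divfK// gt_eqF.
have h1 := poisson_mean_stein_diff_norm_le lam0 h01; rewrite -/D in h1.
have h2 := binomial_poisson_le n DM; rewrite -/lam -/E in h2.
have h3 : `|binomial_mean n (fun k => D k.+1 - D k)| <= 2 * M * B.
  by apply: binomial_mean_shift_le => // k; rewrite ler_norml; have := DM k; lra.
have -> : binomial_mean n D = poisson_mean lam D + (binomial_mean n.+1 D - poisson_mean lam D)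
    - p * binomial_mean n (fun k => D k.+1 - D k).
  by rewrite -binomial_mean_diff; ring.
move: h1 h2 h3; set x := poisson_mean lam D; set y := _ - x; set z := binomial_mean _ _.
move=> h1 h2 h3; rewrite normrM gtr0_norm ?mulr_gt0//.
have xyz : `|x + y - p * z| <= `|x| + `|y| + p * `|z|.
  apply: (le_trans (ler_normB _ _)); rewrite normrM (gtr0_norm p0) lerD2r.
  exact: ler_normD.
apply: (le_trans (ler_wpM2l _ xyz)); first by rewrite mulr_ge0 ?ltW.
have -> : 3 / 4 * expR (- 1) * p + 2 * E ^+ 2 * p ^+ 2 + 2 * E * p ^+ 2 * B =
   p * (3 / 4 * expR (- 1)) + lam * p * (2 * M * E * p) + lam * p * (p * (2 * M * B)).
  have -> : lam * p * (2 * M * E * p) = 2 * (lam * M) * E * p ^+ 2 by ring.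
  have -> : lam * p * (p * (2 * M * B)) = 2 * (lam * M) * p ^+ 2 * B by ring.
  by rewrite ME; ring.
rewrite [leLHS]mulrDr [X in X + _ <= _]mulrDr; apply: lerD; first apply: lerD.
- have -> : lam * p * `|x| = p * (lam * `|x|) by ring.
  by apply: (ler_wpM2l _ h1); exact: ltW.
- by apply: (ler_wpM2l _ h2); rewrite mulr_ge0// ltW.
- apply: ler_wpM2l; first by rewrite mulr_ge0// ltW.
  by apply: (ler_wpM2l _ h3); exact: ltW.
Qed.
End BinomialMean.

(** * The largest atom of the binomial law *)

Section PoissonMode.
Context {R : realType}.
Implicit Types (lam p : R) (n m k : nat).

Lemma poisson_pmf_le_mode lam m k : 0 < lam -> m%:R <= lam < m.+1%:R ->
  poisson_pmf lam k <= poisson_pmf lam m.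
Proof.
move=> lam0 /andP[mlam lamm].
have step i : i.+1%:R * (poisson_pmf lam i.+1 - poisson_pmf lam i) =
    (lam - i.+1%:R) * poisson_pmf lam i.
  by rewrite mulrBr poisson_pmfS// mulrBl.
apply: unimodal_le_mode => i im.
  rewrite -subr_ge0 -(pmulr_rge0 _ (ltr0Sn R i)) step mulr_ge0 ?poisson_pmf_ge0//.
  by rewrite subr_ge0 (le_trans _ mlam)// ler_nat.
rewrite -subr_le0 -(pmulr_rle0 _ (ltr0Sn R i)) step mulr_le0_ge0 ?poisson_pmf_ge0//.
by rewrite subr_le0 (le_trans (ltW lamm))// ler_nat.
Qed.

(** The mode is at [m]; by [(lam / m) ^+ m <= expR (lam - m)], its mass is at most
    [m ^+ m * expR (- m) / m`!], to which Stirling's formula applies. *)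
Lemma poisson_pmf_le_invsqrt lam m k : (0 < m)%N -> m%:R <= lam < m.+1%:R ->
  poisson_pmf lam k <= (Num.sqrt (2 * pi * m%:R))^-1.
Proof.
move=> m0 mlam; have mR0 : 0 < m%:R :> R by rewrite ltr0n.
have lam0 : 0 < lam by case/andP: mlam => + _; apply: lt_le_trans.
apply: le_trans (poisson_pmf_le_mode k lam0 mlam) _.
have s0 : 0 < 2 * pi * m%:R :> R by rewrite !mulr_gt0// pi_gt0.
have := poisson_sqr_le lam0 m0.
rewrite -ler_pdivlMr// => h.
have p0 := poisson_pmf_ge0 lam m.
rewrite -sqrtrV ?(ltW s0)// -[leLHS]ger0_norm// -sqrtr_sqr ler_wsqrtr//.
apply: le_trans h _; rewrite -[leRHS]mul1r ler_wpM2r ?invr_ge0 ?(ltW s0)//.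
have e0 : 0 <= (lam / m%:R) ^+ m * expR (m%:R - lam).
  by rewrite mulr_ge0 ?expR_ge0 ?exprn_ge0 ?divr_ge0 ?ltW.
rewrite exprn_ile1//.
have : (lam / m%:R) ^+ m <= expR (lam - m%:R).
  rewrite -[X in expR X](_ : m%:R * (lam / m%:R - 1) = _); last by field; rewrite gt_eqF.
  rewrite expRM_natl lerXn2r ?nnegrE ?expR_ge0 ?divr_ge0 ?(ltW lam0)//.
  by have := expR_ge1Dx (lam / m%:R - 1); rewrite addrC subrK.
move=> /(ler_wpM2r (expR_ge0 (m%:R - lam))) /le_trans; apply.
by rewrite -expRD addrC addrA subrK subrr expR0.
Qed.

Lemma binomial_pmf_le1 p n k : 0 < p < 1 -> binomial_pmf n p k <= 1.
Proof.
move=> /andP[p0 p1].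
have pmf_ge0 i : 0 <= binomial_pmf n p i by rewrite binomial_pmf_ge0// !ltW.
have [kn|nk] := ltnP k n.+1; last by rewrite binomial_pmfE bin_small// mulr0.
rewrite -(binomial_mean1 p n) /binomial_mean (bigD1 (Ordinal kn))//= mulr1 lerDl.
by rewrite sumr_ge0// => i _; rewrite mulr1.
Qed.

(** When [n p < 1], in particular for [n = 0], the first reciprocal is [+oo] and
    [epsilon] equals 1. Otherwise both terms of the second member of the minimum
    come from the comparison with the Poisson law of rate [n p]. *)
Lemma binomial_pmf_le_epsilon p n k : 0 < p < 1 ->
  ((binomial_pmf n p k)%:E <= epsilon n.+1 p)%E.
Proof.
move=> p01; have /andP[p0 p1] := p01.
rewrite /epsilon le_min lee_fin binomial_pmf_le1//=.
rewrite (_ : n.+1%:R - 1 = n%:R); last by rewrite -natr1 addrK.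
have e0 : 0 < 1 - expR (- (n.+1%:R * p)).
  by rewrite subr_gt0 expR_lt1 oppr_lt0 mulr_gt0.
set c := 2 * _ * p; have c0 : 0 < c by rewrite !mulr_gt0.
set b := 1 - _^-1.
have b0 : 0 <= b by rewrite subr_ge0 invf_le1 ?ler1n ?ltr0n.
have cb0 : (0 <= c%:E / b%:E)%E by rewrite mule_ge0 ?inve_ge0 ?lee_fin ?(ltW c0).
have b1 : b <= 1 by rewrite gerBl invr_ge0.
have {b1} cb : (c%:E <= c%:E / b%:E)%E.
  rewrite inver; case: eqP => [_|/eqP bn0]; first by rewrite gt0_muley ?leey.
  by rewrite -EFinM lee_fin ler_peMr ?(ltW c0)// invf_ge1// lt_neqAle eq_sym bn0.
have cE : (1 - expR (- (n%:R * p))) * p <= c.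
  have : expR (- (n.+1%:R * p)) <= expR (- (n%:R * p)).
    by rewrite ler_expR lerN2 ler_wpM2r ?(ltW p0)// ler_nat.
  move: e0; rewrite /c; move: (expR _) (expR _) => x y xy1 xy.
  by rewrite ler_wpM2r ?(ltW p0)//; lra.
have := floor_itv (n%:R * p).
have : 0 <= Num.floor (n%:R * p) by rewrite floor_ge0 mulr_ge0// ltW.
case: (Num.floor _) => // -[|m] _.
  move=> _; rewrite mulr0 sqrtr0 inve0 addye ?leey//.
  by rewrite gt_eqF// (lt_le_trans _ cb0)// ltNy0.
move: c b c0 b0 cb0 cb cE => c b c0 b0 cb0 cb.
case: n {e0} => [|n] cE.
  by rewrite mul0r -pmulrn lern0.
rewrite -[(m.+1%:Z + 1)]/(m.+1 + 1)%:Z addn1 -!pmulrn => mlam.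
have mn := poisson_pmf_le_invsqrt k (ltn0Sn m) mlam.
have bn := binomial_pmf_le_poisson p0 p1 n k.
have s0 : 0 < 2 * pi * m.+1%:R :> R by rewrite !mulr_gt0// pi_gt0.
rewrite inver gt_eqF ?sqrtr_gt0//; apply: le_trans (leeD2l _ cb).
by rewrite -EFinD lee_fin; lra.
Qed.
End PoissonMode.

(** * Laws of the two statistics *)

Section LawOfStatistics.
Context {R : realType}.

(** Finite additivity over an arbitrary index sequence. *)
Lemma sum_disjoint_le d (T : measurableType d) (P : probability T R)
    (I : eqType) (s : seq I) (F : I -> set T) (S : set T) :
  uniq s -> (forall i, measurable (F i)) ->
  (forall i j, i != j -> F i `&` F j = set0) ->
  measurable S -> (forall i, i \in s -> F i `<=` S) ->
  (\sum_(i <- s) P (F i) <= P S)%E.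
Proof.
move=> us mF dF; elim: s us S => [_|i s IH /= /andP[iNs us]] S mS FS.
  by rewrite big_nil.
rewrite big_cons.
have FiS : F i `<=` S by apply: FS; rewrite mem_head.
rewrite (measureDI P mS (mF i)) addeC (setIidr FiS); apply: leeD2r.
apply: IH => // [|j js w Fjw]; first exact: measurableD.
split; first by apply: (FS j) => //; rewrite inE js orbT.
move=> Fiw; have ij : i != j by apply: contraNneq iNs => ->.
by have := dF i j ij; rewrite -subset0 => /(_ w); apply; split.
Qed.

Lemma poisson_law d (T : measurableType d) (Q : probability T R) (lam : R)
    (N : {RV Q >-> nat}) (h : nat -> R) (B : set nat) : 0 < lam ->
  is_poisson lam N -> (forall k, h k = \1_B k) ->
  Q (N @^-1` B) = (poisson_mean lam h)%:E.
Proof.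
move=> lam0 hN hB.
have mN k : measurable (N @^-1` [set k]).
  by rewrite -[X in measurable X]setTI; exact: measurable_funP.
pose F k := if k \in B then N @^-1` [set k] else set0.
have -> : N @^-1` B = \bigcup_k F k.
  apply/seteqP; split => [w Bw|w [k _]].
    by exists (N w) => //; rewrite /F mem_set.
  by rewrite /F; case: ifPn => // /set_mem Bk /= ->.
have mF k : measurable (F k) by rewrite /F; case: ifPn.
have FE k : Q (F k) = (poisson_pmf lam k * h k)%:E.
  rewrite /F hB indicE; case: ifPn => _; last by rewrite measure0 mulr0.
  by rewrite hN mulr1.
have tF : trivIset setT F.
  move=> i j _ _ [w []]; rewrite /F; case: ifPn => // _; case: ifPn => // _.
  by move=> /= <- <-.
rewrite measure_semi_bigcup//; last exact: bigcup_measurable.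
apply: cvg_lim => //.
have h01 k : 0 <= h k <= 1 by rewrite hB indicE; case: (_ \in _); rewrite lexx ler01.
have hc := cvg_poisson_mean lam0 h01.
have -> : (fun n => \sum_(0 <= i < n) Q (F i))%E =
    EFin \o series (fun k => poisson_pmf lam k * h k).
  by apply/funext => n; rewrite /= /series/= -sumEFin; apply: eq_bigr.
exact: (cvg_comp _ _ hc).
Qed.

(** There are ['C(n, k)] sets of cardinal [k]. *)
Lemma sum_card_binomial n (p : R) (h : nat -> R) :
  \sum_(J : {set 'I_n}) p ^+ #|J| * (1 - p) ^+ (n - #|J|) * h #|J| =
  binomial_mean p n h.
Proof.
have cn (J : {set 'I_n}) : (#|J| < n.+1)%N by rewrite ltnS -[n in (_ <= n)%N]card_ord max_card.
rewrite (partition_big (fun J : {set 'I_n} => Ordinal (cn J)) xpredT)//=.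
apply: eq_bigr => k _; rewrite binomial_pmfE.
rewrite (eq_bigr (fun=> p ^+ k * (1 - p) ^+ (n - k) * h k)); last first.
  by move=> J /eqP <-.
have := card_draws 'I_n k; rewrite card_ord => <-.
rewrite sumr_const -[LHS]mulr_natr mulrAC; congr (_ * _%:R * _).
by rewrite cardsE; apply: eq_card.
Qed.
End LawOfStatistics.

Section SelfNormalizedLaw.
Context {R : realType}.

(** The function that maps the number of negative variables to the self-normalized
    sum; [normalized_poisson] is by definition its value at a Poisson variable. *)
Definition normalized_count (n : nat) (p : R) (k : nat) : R :=
  (n%:R * p - k%:R) / Num.sqrt (n%:R * p ^+ 2 + (1 - 2 * p) * k%:R).

(** Here [J] is the set of indices of the negative values. Numerator and
    denominator both contain the factor [1 / sqrt (p (1 - p))], which cancels. *)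
Lemma two_point_self_normalized (n : nat) (p : R) (x : 'I_n -> R) (J : {set 'I_n}) :
  0 < p < 1 ->
  (forall i, x i = if i \in J then - Num.sqrt ((1 - p) / p) else Num.sqrt (p / (1 - p))) ->
  (\sum_(i < n) x i) / Num.sqrt (\sum_(i < n) x i ^+ 2) = normalized_count n p #|J|.
Proof.
move=> /andP[p0 p1] xE.
have q0 : 0 < 1 - p by rewrite subr_gt0.
pose s := Num.sqrt (p * (1 - p)).
have pq0 : 0 < p * (1 - p) by rewrite mulr_gt0.
have s0 : 0 < s by rewrite sqrtr_gt0.
have s2 : s ^+ 2 = p * (1 - p) by rewrite sqr_sqrtr// ltW.
have sqrtE (a b : R) : 0 < a -> 0 < b -> a * b = p * (1 - p) -> Num.sqrt (a / b) = a / s.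
  move=> a0 b0 ab; have -> : a / b = (a / s) ^+ 2.
    by rewrite expr_div_n s2 -ab; field; rewrite !gt_eqF.
  by rewrite sqrtr_sqr ger0_norm// divr_ge0 ?ltW.
have count (f g : R) : \sum_(i < n) (if i \in J then f else g) =
    #|J|%:R * f + (n%:R - #|J|%:R) * g.
  rewrite (bigID (mem J))/= (eq_bigr (fun=> f)); last by move=> i ->.
  rewrite [X in _ + X](eq_bigr (fun=> g)); last by move=> i /negPf ->.
  rewrite !sumr_const -[f *+ _]mulr_natl -[g *+ _]mulr_natl; congr (_ + _ * _).
  have -> : n%:R = #|J|%:R + #|predC (mem J)|%:R :> R by rewrite -natrD cardC card_ord.
  by rewrite addrAC subrr add0r.
have -> : \sum_(i < n) x i = (n%:R * p - #|J|%:R) / s.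
  under eq_bigr do rewrite xE (sqrtE p (1 - p))// (sqrtE (1 - p) p) ?[(1 - p) * p]mulrC//.
  by rewrite count; field; rewrite gt_eqF.
have -> : \sum_(i < n) x i ^+ 2 = (n%:R * p ^+ 2 + (1 - 2 * p) * #|J|%:R) / (p * (1 - p)).
  have x2 i : x i ^+ 2 = if i \in J then (1 - p) / p else p / (1 - p).
    by rewrite xE; case: ifP => _; rewrite ?sqrrN sqr_sqrtr// divr_ge0 ?ltW.
  by under eq_bigr do rewrite x2; rewrite count; field; rewrite !gt_eqF.
have D0 : 0 <= n%:R * p ^+ 2 + (1 - 2 * p) * #|J|%:R.
  have : #|J|%:R <= n%:R :> R by rewrite ler_nat -[n in (_ <= n)%N]card_ord max_card.
  rewrite -subr_ge0 => /(mulr_ge0 (sqr_ge0 p)).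
  by have := mulr_ge0 (ler0n R #|J|) (sqr_ge0 (1 - p)); lra.
rewrite sqrtrM// sqrtrV ?(ltW pq0)// -/s /normalized_count.
by rewrite invf_div mulrA divfK// gt_eqF.
Qed.

(** The events [F J], on which exactly the variables indexed by [J] take the
    negative value, are disjoint and have total mass 1. *)
Lemma self_normalized_law d (T : measurableType d) (P : probability T R)
    (n : nat) (p : R) (X : 'I_n -> {RV P >-> R}) (h : nat -> R) (A : set R) :
  0 < p < 1 -> mutually_independent X ->
  (forall i, P (X i @^-1` [set Num.sqrt (p / (1 - p))]) = (1 - p)%:E) ->
  (forall i, P (X i @^-1` [set - Num.sqrt ((1 - p) / p)]) = p%:E) ->
  measurable A -> (forall k, h k = \1_A (normalized_count n p k)) ->
  P (self_normalized_sum X @^-1` A) = (binomial_mean p n h)%:E.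
Proof.
move=> p01 Xind Xpos Xneg mA hA; have /andP[p0 p1] := p01.
set a := Num.sqrt _ in Xpos; set b := - Num.sqrt _ in Xneg.
pose B (J : {set 'I_n}) i : set R := if i \in J then [set b] else [set a].
pose F J := \bigcap_(i in [set` [set: 'I_n]%SET]) (X i @^-1` B J i).
have mB J i : measurable (B J i) by rewrite /B; case: ifP => _; exact: measurable_set1.
have mF J : measurable (F J).
  apply: fin_bigcap_measurable => // i _.
  by rewrite -[X in measurable X]setTI; exact: measurable_funP.
have PF J : P (F J) = (p ^+ #|J| * (1 - p) ^+ (n - #|J|))%:E.
  rewrite /F Xind// (eq_bigr (fun i => (if i \in J then p else 1 - p)%:E)); last first.
    by move=> i _; rewrite /B; case: ifP => _; rewrite ?Xpos ?Xneg.
  rewrite prodEFin; congr (_%:E).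
  rewrite (eq_bigl xpredT); last by move=> i; rewrite inE.
  rewrite (bigID (mem J))/= (eq_bigr (fun=> p)); last by move=> i ->.
  rewrite [X in _ * X](eq_bigr (fun=> 1 - p)); last by move=> i /negPf ->.
  rewrite !prodr_const; congr (_ * _ ^+ _).
  apply/eqP; rewrite -(eqn_add2l #|J|) subnKC ?cardC ?card_ord//.
  by rewrite -[n in (_ <= n)%N]card_ord max_card.
have ba : b != a.
  rewrite lt_eqF// (@lt_trans _ _ 0)// /a /b ?oppr_lt0 sqrtr_gt0 divr_gt0 ?subr_gt0//.
have dF J K : J != K -> F J `&` F K = set0.
  move=> JK; rewrite -subset0 => w [FJ FK]; move/negP: JK; apply; apply/eqP/setP => i.
  have := FJ i; have := FK i; rewrite /= inE => /(_ isT) + /(_ isT).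
  rewrite /B; case: ifP => _; case: ifP => _ //= -> /eqP; first by rewrite (negPf ba).
  by rewrite eq_sym (negPf ba).
have UF J w : F J w -> self_normalized_sum X w = normalized_count n p #|J|.
  move=> FJw; apply: (two_point_self_normalized p01) => i.
  have := FJw i; rewrite /= inE => /(_ isT); rewrite /B.
  by case: ifP => _ /= ->.
pose U := self_normalized_sum X : T -> R.
have mU C : measurable C -> measurable (U @^-1` C).
  by move=> mC; rewrite -[X in measurable X]setTI; exact: measurable_self_normalized_sum.
(* A lower bound suffices: the bounds for A and for its complement add up to 1. *)
have lower C g : measurable C -> (forall k, g k = \1_C (normalized_count n p k)) ->
    ((binomial_mean p n g)%:E <= P (U @^-1` C))%E.
  move=> mC gC.
  pose r := [seq J : {set 'I_n} <- index_enum _ | normalized_count n p #|J| \in C].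
  have -> : (binomial_mean p n g)%:E = (\sum_(J <- r) P (F J))%E.
    rewrite -sum_card_binomial -sumEFin /r big_filter [in RHS]big_mkcond/=.
    apply: eq_bigr => J _; rewrite gC indicE PF.
    by case: ifP => _; rewrite ?mulr1 ?mulr0.
  apply: sum_disjoint_le => //; first by rewrite filter_uniq// index_enum_uniq.
    exact: mU.
  move=> J; rewrite mem_filter => /andP[/set_mem CJ _] w /UF Uw.
  by rewrite /U /= Uw.
have le1 := lower A h mA hA.
have hC k : (fun k => 1 - h k) k = \1_(~` A) (normalized_count n p k).
  rewrite hA !indicE in_setC.
  by case: (_ \in A); rewrite /= ?subrr ?subr0.
have := lower (~` A) _ (measurableC mA) hC.
rewrite preimage_setC probability_setC; last exact: mU.
have -> : binomial_mean p n (fun k => 1 - h k) = 1 - binomial_mean p n h.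
  rewrite -[X in _ = X - _](binomial_mean1 p n) /binomial_mean -sumrB.
  by apply: eq_bigr => k _; ring.
move=> le2; apply/eqP; rewrite eq_le le1 andbT.
have := fin_num_measure P _ (mU _ mA).
move: le1 le2; rewrite /U; move: (P _) => [r| |]//.
by rewrite -EFinB !lee_fin => _ + _; lra.
Qed.
End SelfNormalizedLaw.

(** * The total variation bound *)

Theorem proposition3 (R : realType) (n : nat) (hn : (1 <= n)%N)
    (p q : R) (hp0 : 0 < p) (hp1 : p <= 1 / 2) (hq : q = 1 - p)
    (d : measure_display) (T : measurableType d) (P : probability T R)
    (X : 'I_n -> {RV P >-> R})
    (hXindep : mutually_independent X)
    (hXpos : forall i, P (X i @^-1` [set Num.sqrt (p / q)]) = q%:E)
    (hXneg : forall i, P (X i @^-1` [set - Num.sqrt (q / p)]) = p%:E)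
    (d' : measure_display) (T' : measurableType d') (Q : probability T' R)
    (N : {RV Q >-> nat}) (hN : is_poisson (n%:R * p) N) :
  (dTV (self_normalized_sum X : {RV P >-> R})
       (normalized_poisson n p N : {RV Q >-> R})
   <= (3 * p / (4 * expR 1))%:E
      + (2 * (1 - expR (- (n%:R * p))) ^+ 2 * p ^+ 2)%:E
      + (2 * (1 - expR (- (n%:R * p))) * p ^+ 2)%:E * epsilon n p)%E.
Proof.
case: n hn X hXindep hXpos hXneg hN => // n _ X hXindep hXpos hXneg hN.
subst q; have p01 : 0 < p < 1 by rewrite hp0/=; lra.
have p1 : p < 1 by case/andP: p01.
have lam0 : 0 < n.+1%:R * p by rewrite mulr_gt0.
(* epsilon is at most 1, hence finite *)
have [B epsE Bge] : exists2 B : R, epsilon n.+1 p = B%:E &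
    forall k, binomial_pmf n p k <= B.
  have := binomial_pmf_le_epsilon n _ p01.
  have : (epsilon n.+1 p <= 1)%E by rewrite /epsilon ge_min lexx.
  case: (epsilon _ _) => [r _ h|//|_ /(_ 0%N)//].
  by exists r => // k; rewrite -lee_fin.
rewrite epsE -EFinM -!EFinD; apply: ge_ereal_sup => _ [A mA <-].
pose h k : R := \1_A (normalized_count n.+1 p k).
have h01 k : 0 <= h k <= 1 by rewrite /h indicE; case: (_ \in _); rewrite lexx ler01.
have -> : distribution P (self_normalized_sum X) A = (binomial_mean p n.+1 h)%:E.
  exact: (self_normalized_law p01 hXindep hXpos hXneg mA).
have -> : distribution Q (normalized_poisson n.+1 p N) A =
    (poisson_mean (n.+1%:R * p) h)%:E.
  by apply: (@poisson_law _ _ _ _ _ _ _ (normalized_count n.+1 p @^-1` A) lam0 hN).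
rewrite -EFinB abse_EFin lee_fin.
apply: le_trans (binomial_poisson_second_order hp0 p1 h01 Bge) _.
rewrite [expR (- 1)]expRN le_eqVlt; apply/orP; left; apply/eqP.
by field; rewrite gt_eqF// expR_gt0.
Qed.
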